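(* Let $G$ be a finite simple graph with vertex set $\{u_1,\dots,u_n\}$ and $m_G$ edges, let $r$ be a restraint on $G$, and write, for all integers $x\geq M_{G,r}$, $\pi_r(G,x)=\sum_{i=0}^n(-1)^{n-i}a_i(G,r)x^i$. Then $$a_{n-3}(G,r)=A_0(G)+\sum_{i=1}^8A_i(G,r),$$ where \begin{align*} A_0(G)&={m_G\choose 3}-(m_G-2)\eta_G(C_3)-i_G(C_4)+2\eta_G(K_4),\\ A_1(G,r)&=\sum_{i<j<k}|r(u_i)|\,|r(u_j)|\,|r(u_k)|,\\ A_2(G,r)&=(m_G-1)\sum_{i<j}|r(u_i)|\,|r(u_j)|,\\ A_3(G,r)&=\sum_{i<j,\ u_iu_j\notin E(G)}|r(u_i)|\,|r(u_j)|,\\ A_4(G,r)&=-\sum_{u_iu_j\in E(G)}|r(u_i)\cap r(u_j)|\sum_{k\notin\{i,j\}}|r(u_k)|,\\ A_5(G,r)&=\Big({m_G\choose 2}-\eta_G(C_3)\Big)\sum_{i=1}^n|r(u_i)|,\\ A_6(G,r)&=-(m_G-1)\sum_{u_iu_j\in E(G)}|r(u_i)\cap r(u_j)|,\\ A_7(G,r)&=\sum_{u_iu_j\in E(G)}|N_G(u_i)\cap N_G(u_j)|\,|r(u_i)\cap r(u_j)|-\sum_{u_i\in V(G)}\ \sum_{u_j,u_k\in N_G(u_i),\ j<k}|r(u_j)\cap r(u_k)|,\\ A_8(G,r)&=\frac12\sum_{u_iu_j\in E(G)}\ \sum_{k\notin\{i,j\},\ u_k\in N_G(u_i)\cup N_G(u_j)}|r(u_i)\cap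 r(u_j)\cap r(u_k)|\\ &\quad+\frac16\sum_{u_iu_j\in E(G)}\ \sum_{u_k\in N_G(u_i)\cap N_G(u_j)}|r(u_i)\cap r(u_j)\cap r(u_k)|. \end{align*} Here sums over $u_iu_j\in E(G)$ run over edges (each edge counted once), $N_G(u)$ is the neighbourhood of $u$, $\eta_G(H)$ is the number of subgraphs of $G$ isomorphic to $H$, and $i_G(H)$ is the number of induced subgraphs of $G$ isomorphic to $H$.
   Context: A restraint $r$ on a graph $G$ assigns to each vertex $v$ a finite set $r(v)\subset\mathbb{N}$ of forbidden colours. A proper $x$-colouring $c:V(G)\to\{1,\dots,x\}$ is permitted by $r$ if $c(v)\notin r(v)$ for every vertex $v$. The restrained chromatic polynomial $\pi_r(G,x)$ is the number of proper $x$-colourings of $G$ permitted by $r$. $M_{G,r}$ denotes the maximum element of $\bigcup_{v}r(v)$ if this set is nonempty, and $0$ otherwise. For $x\geq M_{G,r}$, $\pi_r(G,x)$ agrees with a monic polynomial of degree $n$ in $x$ with integer coefficients; the $a_i(G,r)$ are defined via this polynomial. *)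

(* Defs.v *)
From HB Require Import structures.
From mathcomp Require Import all_boot all_order all_algebra.
From mathcomp Require Import finmap.

Set Implicit Arguments.
Unset Strict Implicit.
Unset Printing Implicit Defensive.

Import Order.TTheory GRing.Theory Num.Theory.

Record sgraph (T : finType) := SGraph {
  adj :> rel T;
  adj_sym : symmetric adj;
  adj_irr : irreflexive adj }.

Definition edges (T : finType) (G : sgraph T) : {set {set T}} :=
  [set [set p.1; p.2] | p : T * T & G p.1 p.2].

Definition nedges (T : finType) (G : sgraph T) : nat := #|edges G|.

Definition nbr (T : finType) (G : sgraph T) (u : T) : {set T} :=
  [set v | G u v].

(* A subgraph is a pair (vertex set, edge set), not necessarily induced. *)
Definition is_subgraph (T : finType) (G : sgraph T)
    (K : {set T} * {set {set T}}) : bool :=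
  (K.2 \subset edges G) && [forall e in K.2, e \subset K.1].

Definition subgraph_iso (T : finType) (K : {set T} * {set {set T}})
    (U : finType) (H : sgraph U) : bool :=
  [exists f : {ffun U -> T},
    [&& injectiveb f, f @: [set: U] == K.1
      & [set f @: (e : {set U}) | e in edges H] == K.2]].

Definition n_subgraphs (T : finType) (G : sgraph T)
    (U : finType) (H : sgraph U) : nat :=
  #|[set K | is_subgraph G K && subgraph_iso K H]|.

Definition induced_subgraph (T : finType) (G : sgraph T) (W : {set T}) :
    {set T} * {set {set T}} :=
  (W, [set e in edges G | e \subset W]).

Definition n_induced (T : finType) (G : sgraph T)
    (U : finType) (H : sgraph U) : nat :=
  #|[set W | subgraph_iso (induced_subgraph G W) H]|.

Section CyclesAndCliques.
Variable k : nat.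

(* The guard i != j only matters for k = 1, where ordS i = i. *)
Definition cycle_rel : rel 'I_k :=
  [rel i j | (i != j) && ((j == ordS i) || (i == ordS j))].

Lemma cycle_rel_sym : symmetric cycle_rel.
Proof. by move=> i j; rewrite /cycle_rel /= eq_sym orbC. Qed.

Lemma cycle_rel_irr : irreflexive cycle_rel.
Proof. by move=> i; rewrite /cycle_rel /= eqxx. Qed.

Definition cycle_graph := SGraph cycle_rel_sym cycle_rel_irr.

Definition complete_rel : rel 'I_k := [rel i j | i != j].

Lemma complete_rel_sym : symmetric complete_rel.
Proof. by move=> i j; rewrite /complete_rel /= eq_sym. Qed.

Lemma complete_rel_irr : irreflexive complete_rel.
Proof. by move=> i; rewrite /complete_rel /= eqxx. Qed.

Definition complete_graph := SGraph complete_rel_sym complete_rel_irr.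

End CyclesAndCliques.

(* Colours are the positive integers 1, 2, 3, ...; hence 0 is never forbidden
   (a forbidden 0 would not constrain colourings yet would count in |r(v)|). *)
Record restraint (T : finType) := Restraint {
  forbidden :> T -> {fset nat};
  forbidden_gt0 : forall v k, k \in forbidden v -> (0 < k)%N }.

Section Colourings.
Variables (T : finType) (G : sgraph T) (r : restraint T).

Definition max_forbidden : nat := \max_(v : T) \max_(k <- r v) k.

(* The index i : 'I_x stands for the colour i + 1 in {1, ..., x}. *)
Definition colour x (i : 'I_x) : nat := i.+1.

Definition proper_colouring x (c : {ffun T -> 'I_x}) : bool :=
  [forall u, forall v, G u v ==> (colour (c u) != colour (c v))].

Definition permitted x (c : {ffun T -> 'I_x}) : bool :=
  [forall v, colour (c v) \notin r v].

Definition n_restrained_colourings (x : nat) : nat :=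
  #|[set c : {ffun T -> 'I_x} | proper_colouring c && permitted c]|.

End Colourings.

Local Open Scope ring_scope.

(* a_0, ..., a_n are the (unsigned) coefficients of the restrained chromatic
   polynomial; values of a beyond n are irrelevant. *)
Definition restrained_coeffs (n : nat) (G : sgraph 'I_n) (r : restraint 'I_n)
    (a : nat -> int) : Prop :=
  forall x : nat, (max_forbidden r <= x)%N ->
    (n_restrained_colourings G r x)%:Z
      = \sum_(i < n.+1) (-1) ^+ (n - i) * a i * x%:Z ^+ i.

(* Existence of the coefficients (with integer, monic polynomial): expand the
   product over adjacent pairs p of 1 - [c p.1 = c p.2]; the colourings that are
   constant on the components of S and permitted are counted by blockpoly S. *)
Section Existence.
Variables (T : finType) (G : sgraph T) (r : restraint T).

Let M := max_forbidden r.

Let forbidden_le v k : k \in r v -> (k <= M)%N.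
Proof.
move=> kv; apply: leq_trans (leq_bigmax v).
by rewrite (big_rem k) //= leq_maxl.
Qed.

Let card_allowed (U : {fset nat}) x :
    {in U, forall k, (0 < k <= x)%N} ->
  #|[pred i : 'I_x | colour i \notin U]|%:Z = x%:Z - #|` U|%:Z.
Proof.
move=> HU.
have <- : (#|[pred i : 'I_x | colour i \in U]| = #|` U|)%N.
  rewrite cardE -(size_map (@colour x)); apply: perm_size; apply: uniq_perm.
  - by rewrite map_inj_uniq ?enum_uniq // => i j [] /val_inj.
  - exact: fset_uniq.
  move=> k; apply/mapP/idP => [[i]|kU]; first by rewrite mem_enum => ? ->.
  have /andP[k0 kx] := HU k kU.
  have lt : (k.-1 < x)%N by rewrite prednK.
  exists (Ordinal lt); last by rewrite /colour /= prednK.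
  by rewrite mem_enum inE /colour /= prednK.
have := cardC [pred i : 'I_x | colour i \in U]; rewrite card_ord.
move/(congr1 Posz); rewrite PoszD => H; apply/eqP; rewrite eq_sym subr_eq -H.
by rewrite addrC; apply/eqP; congr (_ + _); congr Posz; apply: eq_card => i.
Qed.

Section EdgeSet.
Variable S : {set T * T}.

Let e : rel T := [rel u v | ((u, v) \in S) || ((v, u) \in S)].
Let e_sym : connect_sym e.
Proof. by apply: sym_connect_sym => u v; rewrite /e /= orbC. Qed.

Let R := {v : T | roots e v}.
Let rt (v : T) : R := Sub (fingraph.root e v) (roots_root e_sym v).

Let U (v : R) : {fset nat} := (\bigcup_(w | fingraph.root e w == val v) r w)%fset.

Let UP (v : R) k :
  reflect (exists2 w, fingraph.root e w = val v & k \in r w) (k \in U v).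
Proof.
apply: (iffP (bigfcupP _ _ _ _)) => [[w /andP[_ /eqP wv] kw]|[w wv kw]].
  by exists w.
by exists w => //; rewrite mem_index_enum wv eqxx.
Qed.

Definition blockpoly : {poly int} :=
  \prod_(v : R) ('X - (#|` U v|%:Z)%:P).

Lemma blockpolyE x : (M <= x)%N ->
  #|[set c : {ffun T -> 'I_x} |
      [forall p in S, c p.1 == c p.2] && permitted r c]|%:Z = blockpoly.[x%:Z].
Proof.
move=> Mx.
pose F (v : R) : pred 'I_x := [pred i | colour i \notin U v].
pose h (g : {ffun R -> 'I_x}) : {ffun T -> 'I_x} := [ffun v => g (rt v)].
have rtK (v : R) : rt (val v) = v.
  by apply: val_inj => /=; apply/eqP; exact: (valP v).
have h_inj : injective h.
  by move=> g g' /ffunP E; apply/ffunP => v; have := E (val v); rewrite !ffunE rtK.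
have -> : [set c : {ffun T -> 'I_x} |
      [forall p in S, c p.1 == c p.2] && permitted r c]
    = h @: [set g in family F].
  apply/setP => c; rewrite inE; apply/andP/imsetP => [[/forall_inP cS /forallP cr]|].
    have cc u v : connect e u v -> c u = c v.
      move=> /connectP[p]; elim: p u => [|w p IH] u /=; first by move=> _ ->.
      move=> /andP[uw /IH{}IH /IH <-].
      by case/orP: uw => /cS/eqP.
    exists [ffun v : R => c (val v)]; last first.
      by apply/ffunP => v; rewrite !ffunE /=; apply: cc; exact: connect_root.
    rewrite inE; apply/familyP => v; rewrite ffunE inE.
    apply/negP => /UP[w wv]; apply/negP; rewrite -wv.
    by rewrite -(cc w) ?cr // connect_root.
  case=> g; rewrite inE => /familyP gF ->; split.
    apply/forall_inP => -[u v] uvS /=; rewrite !ffunE; apply/eqP; congr (g _).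
    apply: val_inj => /=; apply/eqP; rewrite root_connect //; apply: connect1.
    by rewrite /e /= uvS.
  apply/forallP => v; rewrite ffunE; have := gF (rt v); rewrite inE.
  by apply: contra => kv; apply/UP; exists v.
rewrite card_imset // cardsE card_family.
rewrite /blockpoly horner_prod foldrE big_map (big_morph Posz PoszM (erefl _)) big_enum /=.
apply: eq_bigr => v _; rewrite hornerXsubC; apply: card_allowed.
move=> k /UP[w _ kw]; rewrite (forbidden_gt0 kw) /=.
exact: leq_trans (forbidden_le kw) Mx.
Qed.

Lemma size_blockpoly : (size blockpoly = #|{: R}|.+1)%N.
Proof. by rewrite /blockpoly size_prod_XsubC cardT enumT. Qed.

Lemma monic_blockpoly : blockpoly \is monic.
Proof. by apply: monic_prod => v _; exact: monicXsubC. Qed.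

Lemma card_roots_lt p : p \in S -> p.1 != p.2 -> (#|{: R}| < #|T|)%N.
Proof.
case: p => u v /= uvS uv; rewrite card_sig.
have ruv : fingraph.root e u = fingraph.root e v.
  by apply/eqP; rewrite root_connect // connect1 // /e /= uvS.
apply: proper_card; apply/properP; split; first by apply/subsetP.
case/boolP: (roots e u) => ur; last by exists u; rewrite // inE.
exists v; rewrite // inE /in_mem /=.
by apply: contra uv => /eqP; rewrite -ruv (eqP ur) => ->.
Qed.

Lemma card_roots_set0 : S = set0 -> (#|{: R}| = #|T|)%N.
Proof.
move=> S0; rewrite card_sig; apply: eq_card => v; rewrite inE.
have /connectP[[|w p]] := connect_root e v; first by move=> _ /= E; apply/eqP.
by rewrite /= /e /= S0 !inE.
Qed.

End EdgeSet.

Let E : {set T * T} := [set p | G p.1 p.2].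

Definition restrained_poly : {poly int} :=
  \sum_(S in powerset E) (-1) ^+ #|S| *: blockpoly S.

Lemma restrained_polyE x : (max_forbidden r <= x)%N ->
  (n_restrained_colourings G r x)%:Z = restrained_poly.[x%:Z].
Proof.
move=> Mx; rewrite /restrained_poly horner_sum.
under [RHS]eq_bigr => S _ do rewrite hornerZ -blockpolyE //.
have card_int (P : pred {ffun T -> 'I_x}) :
    #|[set c | P c]|%:Z = \sum_c (P c)%:R.
  rewrite -sum1_card (big_morph Posz PoszD (erefl _)) big_mkcond.
  by apply: eq_bigr => c _; rewrite inE; case: (P c).
rewrite /n_restrained_colourings card_int.
under [RHS]eq_bigr => S _ do rewrite card_int mulr_sumr.
rewrite exchange_big; apply: eq_bigr => c _ /=.
have -> : proper_colouring G c = [forall p in E, c p.1 != c p.2].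
  apply/forallP/forall_inP => [H [u v]|H u].
    by rewrite inE => /= uv; have /forallP/(_ v) := H u; rewrite uv.
  by apply/forallP => v; apply/implyP => uv; apply: (H (u, v)); rewrite inE.
have andE (A B : bool) : (A && B)%:R = A%:R * B%:R :> int by case: A; case: B.
rewrite andE; under [RHS]eq_bigr => S _ do rewrite andE mulrA.
rewrite -mulr_suml; congr (_ * _).
have allE (D : {set T * T}) (Q : pred (T * T)) :
    [forall p in D, Q p]%:R = \prod_(p in D) (Q p)%:R :> int.
  case: forall_inP => [H|H]; first by rewrite big1 // => p /H ->.
  have [p pD Qp] : exists2 p, p \in D & ~~ Q p.
    by apply/exists_inP; rewrite -negb_forall_in; apply/forall_inP.
  by rewrite (bigD1 p) //= (negbTE Qp) mul0r.
rewrite allE big_mkcond /=.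
pose F p : int := if p \in E then - (c p.1 == c p.2)%:R else 0.
rewrite (eq_bigr (fun p => F p + 1)); last first.
  by move=> p _; rewrite /F; case: (p \in E); rewrite ?add0r //; case: (c p.1 == c p.2).
rewrite bigA_distr [RHS]big_mkcond; apply: eq_bigr => S _ /=.
rewrite -big_mkcond powersetE; case: ifPn => [/subsetP SE|].
  rewrite allE -prodrN; apply: eq_bigr => p /SE pE.
  by rewrite /F pE.
by move=> /subsetPn[p pS pE]; rewrite (bigD1 p) //= /F (negbTE pE) mul0r.
Qed.

Lemma restrained_poly_monic :
  restrained_poly \is monic /\ size restrained_poly = #|T|.+1.
Proof.
have H0 : size (blockpoly set0) = #|T|.+1.
  by rewrite size_blockpoly card_roots_set0.
pose q := \sum_(S in powerset E | S != set0) (-1) ^+ #|S| *: blockpoly S : {poly int}.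
have -> : restrained_poly = blockpoly set0 + q.
  by rewrite /restrained_poly (bigD1 set0) ?powersetE ?sub0set //= cards0 expr0 scale1r.
have sq : (size q < size (blockpoly set0))%N.
  rewrite H0 ltnS; apply: (leq_trans (size_sum _ _ _)).
  apply/bigmax_leqP => S /andP[]; rewrite powersetE => /subsetP SE /set0Pn[p pS].
  apply: (leq_trans (size_scale_leq _ _)); rewrite size_blockpoly.
  apply: (card_roots_lt pS); have := SE p pS; rewrite inE.
  by apply: contraTneq => ->; rewrite adj_irr.
split; last by rewrite size_polyDl.
by rewrite monicE lead_coefDl // -monicE monic_blockpoly.
Qed.

End Existence.

Lemma restrained_coeffs_exist n (G : sgraph 'I_n) (r : restraint 'I_n) :
  exists2 a, restrained_coeffs G r a & a n = 1.
Proof.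
have [pm ps] := restrained_poly_monic G r; rewrite card_ord in ps.
exists (fun i => (-1) ^+ (n - i) * (restrained_poly G r)`_i); last first.
  by rewrite subnn mul1r; move/monicP: pm; rewrite /lead_coef ps.
move=> x Mx; rewrite restrained_polyE // horner_coef ps.
by apply: eq_bigr => i _; rewrite mulrA -exprMn mulrNN mulr1 expr1n mul1r.
Qed.

Section Coefficients.
Variables (n : nat) (G : sgraph 'I_n) (r : restraint 'I_n).

Let m : rat := (nedges G)%:R.
Let eta k (H : sgraph 'I_k) : rat := (n_subgraphs G H)%:R.
Let ind k (H : sgraph 'I_k) : rat := (n_induced G H)%:R.

Let r1 (i : 'I_n) : rat := #|` r i|%:R.
Let r2 (i j : 'I_n) : rat := #|` (r i `&` r j)%fset|%:R.
Let r3 (i j k : 'I_n) : rat := #|` (r i `&` r j `&` r k)%fset|%:R.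

(* A sum over edges u_i u_j is a sum over pairs i < j with G i j. *)

Definition A0 : rat :=
  'C(nedges G, 3)%:R - (m - 2) * eta (cycle_graph 3)
  - ind (cycle_graph 4) + 2 * eta (complete_graph 4).

Definition A1 : rat :=
  \sum_(i < n) \sum_(j < n | (i < j)%N) \sum_(k < n | (j < k)%N)
    r1 i * r1 j * r1 k.

Definition A2 : rat :=
  (m - 1) * \sum_(i < n) \sum_(j < n | (i < j)%N) r1 i * r1 j.

Definition A3 : rat :=
  \sum_(i < n) \sum_(j < n | (i < j)%N && ~~ G i j) r1 i * r1 j.

Definition A4 : rat :=
  - \sum_(i < n) \sum_(j < n | (i < j)%N && G i j)
      (r2 i j * \sum_(k < n | k \notin [set i; j]) r1 k).

Definition A5 : rat :=
  ('C(nedges G, 2)%:R - eta (cycle_graph 3)) * \sum_(i < n) r1 i.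

Definition A6 : rat :=
  - (m - 1) * \sum_(i < n) \sum_(j < n | (i < j)%N && G i j) r2 i j.

Definition A7 : rat :=
  \sum_(i < n) \sum_(j < n | (i < j)%N && G i j)
    #|nbr G i :&: nbr G j|%:R * r2 i j
  - \sum_(i < n) \sum_(j in nbr G i) \sum_(k in nbr G i | (j < k)%N) r2 j k.

Definition A8 : rat :=
  1 / 2 * (\sum_(i < n) \sum_(j < n | (i < j)%N && G i j)
    \sum_(k < n | (k \notin [set i; j]) && (k \in nbr G i :|: nbr G j)) r3 i j k)
  + 1 / 6 * (\sum_(i < n) \sum_(j < n | (i < j)%N && G i j)
    \sum_(k in nbr G i :&: nbr G j) r3 i j k).

End Coefficients.

(* Main.v *)
Require Import Defs.
From mathcomp Require Import all_boot all_order all_algebra.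
From mathcomp Require Import finmap.
From mathcomp Require Import zify ring.
Import Order.TTheory GRing.Theory Num.Theory.
Local Open Scope ring_scope.

(* Induction on the number of edges by deletion-contraction. If G = H + uv, then
   x pi_r(G, x) = x pi_r(H, x) - pi_r'(H/uv, x), where the contraction H/uv keeps
   v as an isolated unrestrained vertex (whence the factor x) and r' forbids
   r(u) U r(v) at u. Hence a_{n-k}(G, r) = a_{n-k}(H, r) + a_{n-k+1}(H/uv, r'),
   which yields in turn closed formulas for a_{n-1}, a_{n-2} and a_{n-3}.
   With N = N(u) cap N(v) and N' = N(u) cup N(v) in H, adding uv creates |N|
   triangles and one K_4 per edge inside N; it destroys one induced C_4 per
   non-edge inside N and creates one per edge between N(u) \ N(v) and
   N(v) \ N(u). These changes match the numbers of edges and triangles of H/uv,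
   whose merged vertex has neighbourhood N'. *)

Set Implicit Arguments.
Unset Strict Implicit.
Unset Printing Implicit Defensive.

(** The induction hypothesis is applied to H only, with the restraint fixed. The contraction, whose
    restraint changes, enters through the closed formula of one order less, already proved for every
    graph and every restraint; so each step only checks that both sides have the same increment. To
    make increments computable, counts become rational sums over ordered tuples of products of 0-1
    adjacency factors. A new edge changes such a sum by explicit terms, and the step ends in
    [field]. Origin of the terms of A_0: H/uv has m - |N| edges, m being the number of edges of H,
    so the binomial in its second-order formula contains |N|^2, a quadratic term supplied by the
    loss of induced four-cycles. That loss counts the edges inside N with the wrong sign; the
    correction is 2 per such edge, whence the coefficient 2 of the number of K_4. Triple
    intersections come from inclusion-exclusion for (r(u) U r(v)) cap r(k) in the overlap term of
    the contraction. *)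

Section Edges.
Variable T : finType.
Implicit Types (G : sgraph T).

Lemma set2_eq (i j u v : T) : ([set i; j] == [set u; v]) =
  ((i == u) && (j == v)) || ((i == v) && (j == u)).
Proof.
apply/eqP/orP => [/setP E|[] /andP[/eqP-> /eqP->] //]; last by rewrite setUC.
have := E i; have := E j; have := E u; have := E v; rewrite !inE !eqxx ?orbT.
rewrite !(eq_sym u) !(eq_sym v).
by case: (i == u); case: (j == v); case: (i == v); case: (j == u); rewrite //=; auto.
Qed.

Lemma in_edges G i j : ([set i; j] \in edges G) = G i j.
Proof.
apply/imsetP/idP => [[[x y]]|ij]; last by exists (i, j); rewrite ?inE.
rewrite inE /= => xy /eqP; rewrite set2_eq.
by case/orP => /andP[/eqP-> /eqP->]; rewrite // adj_sym.
Qed.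

Lemma edgesP G (e : {set T}) : reflect (exists i j, G i j /\ e = [set i; j]) (e \in edges G).
Proof.
apply: (iffP imsetP) => [[[i j]]|[i [j [ij ->]]]]; first by rewrite inE => /= ij ->; exists i, j.
by exists (i, j); rewrite ?inE.
Qed.

Lemma adj_neq G i j : G i j -> i != j.
Proof. by apply: contraTneq => ->; rewrite adj_irr. Qed.

End Edges.

(** * Deletion and contraction *)

(** Relational, so that an induction step sees [G] only through its adjacency in terms of [H], not
    through the test inside [del_edge]. *)
Definition edge_extension (T : finType) (H G : sgraph T) (u v : T) : Prop :=
  [/\ u != v, ~~ H u v &
      forall i j, G i j = [|| H i j, (i == u) && (j == v) | (i == v) && (j == u)]].

Section DeletionContraction.
Variable T : finType.
Implicit Types (G H : sgraph T) (r : restraint T) (u v : T).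

Section Deletion.
Variables (G : sgraph T) (u v : T).

Definition del_rel : rel T := [rel i j | G i j && ([set i; j] != [set u; v])].

Lemma del_rel_sym : symmetric del_rel.
Proof. by move=> i j; rewrite /del_rel /= adj_sym setUC. Qed.

Lemma del_rel_irr : irreflexive del_rel.
Proof. by move=> i; rewrite /del_rel /= adj_irr. Qed.

Definition del_edge := SGraph del_rel_sym del_rel_irr.
End Deletion.

Lemma del_edgeP G u v : G u v -> edge_extension (del_edge G u v) G u v.
Proof.
move=> uv; split=> [||i j].
- by apply: contraTneq uv => ->; rewrite adj_irr.
- by rewrite /= /del_rel /= eqxx andbF.
rewrite /= /del_rel /= set2_eq.
case: (boolP ((i == u) && (j == v) || _)) => [|_]; last by rewrite andbT orbF.
by case/orP => /andP[/eqP-> /eqP->]; rewrite ?(adj_sym G v) uv.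
Qed.

Section ExtensionFacts.
Variables (H G : sgraph T) (u v : T).
Hypothesis ext : edge_extension H G u v.

Lemma extension_neq : u != v. Proof. by case: ext. Qed.

Lemma extension_adj : G u v.
Proof. by case: ext => _ _ ->; rewrite !eqxx orbT. Qed.

Lemma extension_nadj : H u v = false.
Proof. by case: ext => _ /negbTE. Qed.

Lemma extension_old i j : i \notin [set u; v] -> G i j = H i j.
Proof.
case: ext => _ _ ->; rewrite !inE negb_or => /andP[/negbTE-> /negbTE->].
by rewrite orbF.
Qed.

Lemma extension_old_r i j : i \notin [set u; v] -> G j i = H j i.
Proof. by rewrite !(adj_sym _ j i); apply: extension_old. Qed.

End ExtensionFacts.

Lemma nedges0 G : (forall i j, ~~ G i j) -> nedges G = 0%N.
Proof.
move=> G0; apply/eqP; rewrite cards_eq0; apply/eqP/setP => e; rewrite inE.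
by apply/imsetP => -[[i j]]; rewrite inE /= (negbTE (G0 i j)).
Qed.

Lemma nedges_extension H G u v : edge_extension H G u v ->
  nedges G = (nedges H).+1.
Proof.
move=> [uv Huv HG].
have -> : nedges G = #|[set u; v] |: edges H|.
  congr #|pred_of_set _|; apply/setP => e; rewrite in_setU1; apply/edgesP/orP.
    move=> [i [j []]]; rewrite HG -set2_eq.
    by case/orP => [ij ->|/eqP-> ->]; [right; rewrite in_edges|left].
  case=> [/eqP->|/edgesP[i [j [ij ->]]]].
    by exists u, v; rewrite HG !eqxx orbT.
  by exists i, j; rewrite HG ij.
by rewrite cardsU1 in_edges Huv.
Qed.

Lemma sgraph_ind (P : sgraph T -> Prop) :
    (forall G, (forall i j, ~~ G i j) -> P G) ->
    (forall H G u v, edge_extension H G u v -> P H -> P G) ->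
  forall G, P G.
Proof.
move=> P0 PS G; have [k] := ubnP (nedges G); elim: k G => // k IH G lek.
case: (boolP [exists p : T * T, G p.1 p.2]) => [/existsP[[u v] /= uv]|/existsPn G0].
  have ext := del_edgeP uv; apply: (PS _ _ _ _ ext); apply: IH.
  by rewrite -ltnS -(nedges_extension ext).
by apply: P0 => i j; apply: (G0 (i, j)).
Qed.

(** * Contraction and merged restraints *)

Section Contraction.
Variables (H : sgraph T) (u v : T).

Definition contract_rel : rel T := [rel i j | [&& i != j, i != v, j != v &
  [|| H i j, (i == u) && H v j | (j == u) && H v i]]].

Lemma contract_rel_sym : symmetric contract_rel.
Proof.
move=> i j; rewrite /contract_rel /= (adj_sym H i j) (eq_sym i j).
by case: (j == i); case: (i == v); case: (j == v) => //=; congr (_ || _); rewrite orbC.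
Qed.

Lemma contract_rel_irr : irreflexive contract_rel.
Proof. by move=> i; rewrite /contract_rel /= eqxx. Qed.

(* The merged vertex is u; v remains as an isolated vertex, so that contraction
   does not change the vertex type. *)
Definition contract := SGraph contract_rel_sym contract_rel_irr.
End Contraction.

Section Merge.
Variables (r : restraint T) (u v : T).

Definition merge_fun (w : T) : {fset nat} :=
  if w == v then fset0 else if w == u then (r u `|` r v)%fset else r w.

Lemma merge_fun_gt0 w k : k \in merge_fun w -> (0 < k)%N.
Proof.
rewrite /merge_fun; case: ifP => // _; case: ifP => _; last exact: forbidden_gt0.
by rewrite inE => /orP[]; apply: forbidden_gt0.
Qed.

Definition merge_restraint := Restraint merge_fun_gt0.
End Merge.

(** * Counting colourings under deletion and contraction *)

Lemma colour_eq x (i j : 'I_x) : (colour i == colour j) = (i == j).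
Proof. by rewrite /colour eqSS. Qed.

Lemma proper_colouringP G x (c : {ffun T -> 'I_x}) :
  reflect (forall i j, G i j -> c i != c j) (proper_colouring G c).
Proof.
apply: (iffP forallP) => [cG i j ij|cG i].
  by have /forallP/(_ j) := cG i; rewrite ij colour_eq.
by apply/forallP => j; apply/implyP; rewrite colour_eq; apply: cG.
Qed.

Section Count.
Variables (H G : sgraph T) (u v : T) (r : restraint T) (x : nat).
Hypothesis ext : edge_extension H G u v.

Let D := [set c : {ffun T -> 'I_x} |
  [&& proper_colouring H c, permitted r c & c u == c v]].

(** Permitted colourings of [H] that separate [u] and [v] are those of [G]; the others form [D]. *)
Lemma deletion_count :
  (n_restrained_colourings G r x + #|D| = n_restrained_colourings H r x)%N.
Proof.
have [uv Huv HG] := ext.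
rewrite /n_restrained_colourings -[RHS](cardsID [set c : {ffun T -> 'I_x} | c u == c v]) addnC.
congr addn; apply: eq_card => c; rewrite !inE ?andbA //.
case: (permitted r c); rewrite ?andbF // !andbT andbC.
apply/proper_colouringP/andP => [cG|[/proper_colouringP cH cuv] i j].
  split; first by apply/proper_colouringP => i j ij; apply: cG; rewrite HG ij.
  by apply: cG; rewrite HG !eqxx orbT.
rewrite HG => /or3P[/cH //||] /andP[/eqP-> /eqP->] //.
by rewrite eq_sym.
Qed.

(** A colour and a colouring in [D] give a colouring of the contraction by overwriting the colour of
    [v]. Nothing is lost, since in [D] the old colour of [v] is the one kept at [u]. *)
Lemma contraction_count :
  (x * #|D| = n_restrained_colourings (contract H u v) (merge_restraint r u v) x)%N.
Proof.
have [uv Huv HG] := ext; have vu : v != u by rewrite eq_sym.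
pose f (p : 'I_x * {ffun T -> 'I_x}) : {ffun T -> 'I_x} :=
  [ffun w => if w == v then p.1 else p.2 w].
have -> : (x * #|D| = #|setX [set: 'I_x] D|)%N by rewrite cardsX cardsT card_ord.
rewrite -(@card_in_imset _ _ f); last first.
  move=> [i c] [j d]; rewrite !inE /= => /and3P[_ _ /eqP cuv] /and3P[_ _ /eqP duv] /ffunP E.
  have E' w : w != v -> c w = d w by move=> wv; have := E w; rewrite !ffunE (negbTE wv).
  congr (_, _); first by have := E v; rewrite !ffunE eqxx.
  by apply/ffunP => w; case: (eqVneq w v) => [->|/E' //]; rewrite -cuv -duv E'.
congr #|pred_of_set _|; apply/setP => c; rewrite inE; apply/imsetP/andP.
  move=> [[i d]]; rewrite !inE /= => /and3P[/proper_colouringP dH /forallP dr /eqP duv] ->.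
  split.
    apply/proper_colouringP => j k /and4P[jk jv kv]; rewrite !ffunE (negbTE jv) (negbTE kv).
    case/or3P => [/dH //||] /andP[/eqP->]; rewrite duv; first exact: dH.
    by rewrite eq_sym; apply: dH.
  apply/forallP => w; rewrite ffunE /= /merge_fun; case: ifP => // wv.
  case: ifP => [/eqP->|_]; last exact: dr.
  by rewrite inE negb_or dr duv dr.
move=> [/proper_colouringP cK /forallP cr].
(* Inverse map: the free colour of [v] is split off, and [v] receives the colour of the merged
   vertex. *)
exists (c v, [ffun w => if w == v then c u else c w]); last first.
  by apply/ffunP => w; rewrite !ffunE /=; case: eqP => [->|].
have ru : colour (c u) \notin (r u `|` r v)%fset.
  by have := cr u; rewrite /= /merge_fun (negbTE uv) eqxx.
move: ru; rewrite inE negb_or => /andP[ru rv].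
rewrite !inE /=; apply/and3P; split.
- apply/proper_colouringP => i j ij; rewrite !ffunE.
  have ineqj : i != j by apply: contraTneq ij => ->; rewrite adj_irr.
  (* An edge of [H] at [v] has become an edge at [u]; its other end differs from [u] because [uv] is
     not an edge of [H]. *)
  case: (eqVneq i v) => [iv|iv]; case: (eqVneq j v) => [jv|jv].
  + by move: ineqj; rewrite iv jv eqxx.
  + have vj : H v j by rewrite -iv.
    apply: cK; rewrite /= /contract_rel /= uv jv eqxx vj !orbT !andbT.
    by apply: contraNneq Huv => ->; rewrite adj_sym.
  + have vi : H v i by rewrite -jv adj_sym.
    apply: cK; rewrite /= /contract_rel /= uv iv eqxx vi !orbT !andbT.
    by apply: contraNneq Huv => <-; rewrite adj_sym.
  + by apply: cK; rewrite /= /contract_rel /= iv jv ij ineqj.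
- apply/forallP => w; rewrite ffunE; case: eqP => [->|/eqP wv] //.
  have := cr w; rewrite /= /merge_fun (negbTE wv); case: eqP => [->|] //.
- by rewrite !ffunE eqxx (negbTE uv).
Qed.

End Count.

(** * From counts to polynomials and their coefficients *)

Lemma poly_eq_large (p q : {poly int}) (N : nat) :
  (forall x : nat, (N <= x)%N -> p.[x%:Z] = q.[x%:Z]) -> p = q.
Proof.
move=> pq; apply/eqP; rewrite -subr_eq0; apply: contraT => nz.
have := @max_poly_roots _ (p - q) [seq (N + i)%:Z | i <- iota 0 (size (p - q))] nz.
rewrite size_map size_iota ltnn => -> //.
  apply/allP => _ /mapP[i _ ->]; rewrite /root hornerD hornerN pq ?subrr //.
  exact: leq_addr.
by rewrite map_inj_uniq ?iota_uniq // => i j [] /addnI.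
Qed.

Lemma restrained_poly_extension H G u v r : edge_extension H G u v ->
  'X * restrained_poly G r =
  'X * restrained_poly H r - restrained_poly (contract H u v) (merge_restraint r u v).
Proof.
move=> ext.
apply: (@poly_eq_large _ _ (maxn (max_forbidden r) (max_forbidden (merge_restraint r u v)))) => x.
rewrite geq_max => /andP[x1 x2]; rewrite hornerD hornerN !hornerM hornerX.
rewrite -!restrained_polyE // -(contraction_count _ _ ext) -(deletion_count _ _ ext).
by rewrite PoszM PoszD mulrDr addrK.
Qed.

(** Indexed downwards from the top degree, so that the closed formulas do not mention the number of
    vertices. For [k > #|T|] the truncated subtraction would return the constant term, whence the
    size hypotheses below. *)
Definition acoef G r (k : nat) : int := (-1) ^+ k * (restrained_poly G r)`_(#|T| - k).

Lemma acoef0 G r : acoef G r 0 = 1.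
Proof.
have [/monicP + s] := restrained_poly_monic G r.
by rewrite /acoef subn0 expr0 mul1r /lead_coef s.
Qed.

Lemma acoef_extension H G u v r k : edge_extension H G u v -> (k < #|T|)%N ->
  acoef G r k.+1 = acoef H r k.+1 + acoef (contract H u v) (merge_restraint r u v) k.
Proof.
move=> ext kT.
(* Comparison in degree [#|T| - k]: the factor ['X] lowers the index for [G] and [H] but not for the
   contraction, and the minus sign is absorbed by the change of parity. *)
have /(congr1 (fun p : {poly int} => p`_(#|T| - k.+1).+1)) :=
  restrained_poly_extension r ext.
rewrite coefB !coefXM /= subnSK // /acoef => ->.
by rewrite exprS; ring.
Qed.

(** As [U] lies in 1..x, filtering [iota 1 x] by [U] gives a permutation of [U]. *)
Lemma card_colour_notin (U : {fset nat}) x :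
    {in U, forall k, (0 < k <= x)%N} ->
  #|[pred i : 'I_x | colour i \notin U]|%:Z = x%:Z - #|` U|%:Z.
Proof.
move=> HU; pose V := [seq k <- iota 1 x | k \in U].
have V1 : perm_eq V U.
  apply: uniq_perm; rewrite ?filter_uniq ?iota_uniq // => k.
  rewrite mem_filter mem_iota; case: (boolP (k \in U)) => // /HU /=; lia.
rewrite -(perm_size V1) size_filter.
have -> : #|[pred i : 'I_x | colour i \notin U]| = count (predC (mem U)) (iota 1 x).
  have -> : iota 1 x = index_iota 1 x.+1 by rewrite /index_iota subn1.
  by rewrite -sum1_card -sum1_count big_add1 big_mkord.
have := count_predC (mem U) (iota 1 x); rewrite size_iota.
set A := count _ _; set B := count _ _; lia.
Qed.

Lemma forbidden_le r v k : k \in r v -> (k <= max_forbidden r)%N.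
Proof.
move=> kv; apply: leq_trans (leq_bigmax v).
by rewrite (big_rem k) //= leq_maxl.
Qed.

Lemma restrained_poly_edgeless G r : (forall i j, ~~ G i j) ->
  restrained_poly G r = \prod_(v : T) ('X - (#|` r v|%:Z)%:P).
Proof.
move=> G0; apply: (@poly_eq_large _ _ (max_forbidden r)) => x Mx.
rewrite -restrained_polyE // horner_prod /n_restrained_colourings.
have -> : [set c : {ffun T -> 'I_x} | proper_colouring G c && permitted r c] =
    [set c in family (fun v => [pred i : 'I_x | colour i \notin r v])].
  apply/setP => c; rewrite !inE; apply/andP/familyP => [[_ /forallP cr] v|cr].
    exact: cr.
  split; last by apply/forallP => v; apply: cr.
  by apply/proper_colouringP => i j; rewrite (negbTE (G0 i j)).
rewrite cardsE card_family foldrE big_map (big_morph Posz PoszM (erefl _)) big_enum /=.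
apply: eq_bigr => v _; rewrite hornerXsubC; apply: card_colour_notin => k kv.
by rewrite (forbidden_gt0 kv) (leq_trans (forbidden_le kv) Mx).
Qed.

End DeletionContraction.

(** * Elementary symmetric functions and sums over ordered tuples *)

Section ElementarySymmetric.
Variable R : comNzRingType.
Implicit Types (c : R) (cs : seq R).

Fixpoint elemsym (k : nat) cs : R :=
  match k, cs with
  | 0, _ => 1
  | _.+1, [::] => 0
  | k'.+1, c :: cs' => elemsym k cs' + c * elemsym k' cs'
  end.

Lemma elemsym0 cs : elemsym 0 cs = 1.
Proof. by case: cs. Qed.

Lemma elemsym_gt_size k cs : (size cs < k)%N -> elemsym k cs = 0.
Proof.
elim: cs k => [|c cs IH] [|k] //=; rewrite ltnS => le.
by rewrite !IH ?mulr0 ?addr0 // ltnW.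
Qed.

Lemma coef_prod_XsubC_elemsym cs j k : (j + k)%N = size cs ->
  (\prod_(c <- cs) ('X - c%:P))`_j = (-1) ^+ k * elemsym k cs.
Proof.
elim: cs j k => [|c cs IH] j k /=.
  by move/eqP; rewrite addn_eq0 => /andP[/eqP-> /eqP->]; rewrite big_nil coef1 mulr1.
rewrite big_cons mulrBl coefB coefXM coefCM; case: j => [|j] /=.
  (* In the constant term every root is taken: [k] exceeds the length of the tail, so the summand
     that skips [c] vanishes. *)
  rewrite add0n => ->; rewrite (IH 0%N (size cs)) // exprS /= (@elemsym_gt_size _.+1) //.
  by ring.
rewrite addSn => -[] jk; rewrite (IH j k) //; case: k jk => [|k] jk.
  rewrite nth_default ?mulr0 ?subr0 //; first by rewrite elemsym0.
  by rewrite (size_prod_XsubC _ id) -jk addn0.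
by rewrite (IH j.+1 k) ?exprS -?jk ?addSnnS //; ring.
Qed.

Lemma elemsym1 cs : elemsym 1 cs = \sum_(c <- cs) c.
Proof. by elim: cs => [|c cs IH]; rewrite ?big_nil // big_cons -IH /= elemsym0; ring. Qed.

(** This and the next are Newton's identities without denominators, valid in any commutative ring.
    Power sums are the convenient form because merging two vertices changes only the terms at these
    vertices. *)
Lemma elemsym2 cs : 2 * elemsym 2 cs = (\sum_(c <- cs) c) ^+ 2 - \sum_(c <- cs) c ^+ 2.
Proof.
elim: cs => [|c cs IH]; first by rewrite !big_nil /=; ring.
rewrite !big_cons; have -> : elemsym 2 (c :: cs) = elemsym 2 cs + c * elemsym 1 cs by [].
by rewrite mulrDr IH elemsym1; ring.
Qed.

Lemma elemsym3 cs : 6 * elemsym 3 cs = (\sum_(c <- cs) c) ^+ 3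
  - 3 * (\sum_(c <- cs) c) * (\sum_(c <- cs) c ^+ 2) + 2 * (\sum_(c <- cs) c ^+ 3).
Proof.
elim: cs => [|c cs IH]; first by rewrite !big_nil /=; ring.
rewrite !big_cons; have -> : elemsym 3 (c :: cs) = elemsym 3 cs + c * elemsym 2 cs by [].
have -> : 6 * (elemsym 3 cs + c * elemsym 2 cs) =
  6 * elemsym 3 cs + 3 * c * (2 * elemsym 2 cs) by ring.
by rewrite IH elemsym2; ring.
Qed.

End ElementarySymmetric.

(** * Adjacency sums over ordered tuples *)

Section GraphSums.
Variable T : finType.
Implicit Types (G H : sgraph T) (r : restraint T) (u v : T).

(** Adjacency as a factor rather than a summation condition: adding an edge becomes addition, and
    identities between summands are left to [ring]. *)
Definition adjq G (i j : T) : rat := (G i j)%:R.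

(* Sums over ordered tuples: every edge is counted twice, every path of length 2
   twice and every triangle six times; psum includes the degenerate terms j = k. *)
Definition esum G (F : T -> T -> rat) : rat := \sum_i \sum_j adjq G i j * F i j.
Definition psum G (F : T -> T -> T -> rat) : rat :=
  \sum_i \sum_j \sum_k adjq G i j * adjq G i k * F i j k.
Definition tsum G (F : T -> T -> T -> rat) : rat :=
  \sum_i \sum_j \sum_k adjq G i j * adjq G i k * adjq G j k * F i j k.

Lemma adjq_sym G i j : adjq G i j = adjq G j i.
Proof. by rewrite /adjq adj_sym. Qed.

Lemma adjq_diag G i : adjq G i i = 0.
Proof. by rewrite /adjq adj_irr. Qed.

Lemma adjq_idem G i j : adjq G i j * adjq G i j = adjq G i j.
Proof. by rewrite /adjq; case: (G i j); rewrite ?mulr1 ?mulr0. Qed.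

Lemma sum_delta u (F : T -> rat) : \sum_i (i == u)%:R * F i = F u.
Proof.
rewrite (bigD1 u) //= eqxx mul1r big1 ?addr0 // => i /negbTE->.
by rewrite mul0r.
Qed.

Lemma esum0 G F : (forall i j, ~~ G i j) -> esum G F = 0.
Proof.
move=> G0; rewrite /esum big1 // => i _; rewrite big1 // => j _.
by rewrite /adjq (negbTE (G0 i j)) mul0r.
Qed.

Lemma psum0 G F : (forall i j, ~~ G i j) -> psum G F = 0.
Proof.
move=> G0; rewrite /psum big1 // => i _; rewrite big1 // => j _; rewrite big1 // => k _.
by rewrite /adjq (negbTE (G0 i j)) !mul0r.
Qed.

Lemma tsum0 G F : (forall i j, ~~ G i j) -> tsum G F = 0.
Proof.
move=> G0; rewrite /tsum big1 // => i _; rewrite big1 // => j _; rewrite big1 // => k _.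
by rewrite /adjq (negbTE (G0 i j)) !mul0r.
Qed.

(** * Increments of the sums under a new edge *)

Section Extension.
Variables (H G : sgraph T) (u v : T).
Hypothesis ext : edge_extension H G u v.

(** The disjunction turns into a sum because its three cases exclude each other: [u != v], and [uv]
    is not an edge of [H]. *)
Lemma adjq_extension i j : adjq G i j =
  adjq H i j + (i == u)%:R * (j == v)%:R + (i == v)%:R * (j == u)%:R.
Proof.
have [uv Huv HG] := ext; rewrite /adjq HG -!natrM !mulnb.
have h1 : (i == u) && (j == v) -> ~~ H i j by case/andP => /eqP-> /eqP->.
have h2 : (i == v) && (j == u) -> ~~ H i j.
  by case/andP => /eqP-> /eqP->; rewrite adj_sym.
have h3 : (i == u) && (j == v) -> ~~ ((i == v) && (j == u)).
  by case/andP => /eqP-> _; rewrite (negbTE uv).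
move: h1 h2 h3; set b1 := _ && _; set b2 := _ && _.
by case: (H i j); case: b1; case: b2 => //= h1 h2 h3;
  first [by have := h1 isT | by have := h2 isT | by have := h3 isT | rewrite ?addr0 ?add0r].
Qed.

Let uv_neq : u != v. Proof. by case: ext. Qed.
Let Huv0 : adjq H u v = 0.
Proof. by case: ext => _ /negbTE + _; rewrite /adjq => ->. Qed.
Let Hvu0 : adjq H v u = 0. Proof. by rewrite adjq_sym. Qed.

Lemma row_extension_l F :
  \sum_k adjq G u k * F k = \sum_k adjq H u k * F k + F v.
Proof.
rewrite -(sum_delta v F) -big_split; apply: eq_bigr => k _ /=.
by rewrite adjq_extension eqxx (negbTE uv_neq) /=; ring.
Qed.

Lemma row_extension_r F :
  \sum_k adjq G v k * F k = \sum_k adjq H v k * F k + F u.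
Proof.
rewrite -(sum_delta u F) -big_split; apply: eq_bigr => k _ /=.
by rewrite adjq_extension eqxx (eq_sym v u) (negbTE uv_neq) /=; ring.
Qed.

Lemma esum_extension F : esum G F = esum H F + F u v + F v u.
Proof.
have D x y : F x y = \sum_i \sum_j (i == x)%:R * (j == y)%:R * F i j.
  rewrite -{1}(sum_delta x (F^~ y)); apply: eq_bigr => i _.
  rewrite -[in LHS](sum_delta y (F i)) mulr_sumr; apply: eq_bigr => j _.
  by rewrite mulrA.
rewrite (D u v) (D v u) -!big_split; apply: eq_bigr => i _; rewrite -!big_split.
by apply: eq_bigr => j _ /=; rewrite adjq_extension; ring.
Qed.

(** The new edge creates no common neighbour of its ends, as no vertex is its own neighbour. The two
    variants below need this with one factor already replaced. *)
Lemma common_extension k : adjq G u k * adjq G v k = adjq H u k * adjq H v k.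
Proof.
rewrite !adjq_extension !eqxx (eq_sym v u) (negbTE uv_neq).
case: (eqVneq k u) => [->|ku].
  by rewrite (negbTE uv_neq) adjq_diag Hvu0 /=; ring.
by case: (eqVneq k v) => [->|kv]; rewrite ?adjq_diag ?Huv0 /=; ring.
Qed.

Lemma half_common_extension k : adjq H u k * adjq G v k = adjq H u k * adjq H v k.
Proof.
rewrite !adjq_extension eqxx (eq_sym v u) (negbTE uv_neq).
case: (eqVneq k u) => [->|ku]; rewrite ?adjq_diag /=; ring.
Qed.

Lemma half_common_extension_r k : adjq H v k * adjq G u k = adjq H v k * adjq H u k.
Proof.
rewrite !adjq_extension eqxx (negbTE uv_neq).
case: (eqVneq k v) => [->|ku]; rewrite ?adjq_diag /=; ring.
Qed.

(** The two adjacency factors are replaced one after the other. The hypothesis kills the degenerate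
    tuple that uses the new edge twice. *)
Lemma psum_extension F : (forall i j, F i j j = 0) ->
  psum G F = psum H F + \sum_k adjq H u k * (F u v k + F u k v)
                      + \sum_k adjq H v k * (F v u k + F v k u).
Proof.
move=> F0.
have E1 K : psum K F = esum K (fun i j => \sum_k adjq K i k * F i j k).
  apply: eq_bigr => i _; apply: eq_bigr => j _; rewrite mulr_sumr.
  by apply: eq_bigr => k _; rewrite mulrA.
have E2 : esum H (fun i j => \sum_k adjq G i k * F i j k) =
          esum G (fun i k => \sum_j adjq H i j * F i j k).
  apply: eq_bigr => i _; under eq_bigr do rewrite mulr_sumr.
  rewrite exchange_big; apply: eq_bigr => k _; rewrite mulr_sumr; apply: eq_bigr => j _; ring.
have E3 : esum H (fun i k => \sum_j adjq H i j * F i j k) = psum H F.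
  apply: eq_bigr => i _; under eq_bigr do rewrite mulr_sumr.
  rewrite exchange_big; apply: eq_bigr => k _; apply: eq_bigr => j _; ring.
rewrite E1 esum_extension E2 esum_extension E3 row_extension_l row_extension_r !F0 !addr0.
under [in RHS]eq_bigr do rewrite mulrDr.
rewrite big_split /=.
under [\sum_k adjq H v k * (_ + _)]eq_bigr do rewrite mulrDr.
rewrite big_split /=; ring.
Qed.

(** A new triangle uses the new edge once and its third vertex is a common neighbour; the six values
    of [F] are the orderings of its vertices. *)
Lemma tsum_extension F :
  tsum G F = tsum H F + \sum_k adjq H u k * adjq H v k *
    (F u v k + F v u k + F u k v + F v k u + F k u v + F k v u).
Proof.
(* The three factors pass from [G] to [H] one at a time, each in turn as the outer pair of an
   [esum]. *)
pose t1 K1 K2 K3 := \sum_i \sum_j \sum_k adjq K1 i j * adjq K2 i k * adjq K3 j k * F i j k.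
have S1 : t1 G G G = t1 H G G + \sum_k adjq H u k * adjq H v k * (F u v k + F v u k).
  have E K : t1 K G G = esum K (fun i j => \sum_k adjq G i k * adjq G j k * F i j k).
    apply: eq_bigr => i _; apply: eq_bigr => j _; rewrite mulr_sumr.
    by apply: eq_bigr => k _; rewrite !mulrA.
  rewrite !E esum_extension -addrA -big_split; congr (_ + _); apply: eq_bigr => k _ /=.
  by rewrite [adjq G v k * _]mulrC common_extension; ring.
have S2 : t1 H G G = t1 H H G + \sum_k adjq H u k * adjq H v k * (F u k v + F v k u).
  have E K : t1 H K G = esum K (fun i k => \sum_j adjq H i j * adjq G k j * F i j k).
    apply: eq_bigr => i _; rewrite exchange_big; apply: eq_bigr => k _; rewrite mulr_sumr.
    by apply: eq_bigr => j _; rewrite (adjq_sym G k j); ring.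
  rewrite !E esum_extension -addrA -big_split; congr (_ + _); apply: eq_bigr => k _ /=.
  by rewrite half_common_extension half_common_extension_r; ring.
have S3 : t1 H H G = t1 H H H + \sum_k adjq H u k * adjq H v k * (F k u v + F k v u).
  have E K : t1 H H K = esum K (fun j k => \sum_i adjq H j i * adjq H k i * F i j k).
    rewrite /t1 exchange_big; apply: eq_bigr => j _; rewrite exchange_big.
    apply: eq_bigr => k _; rewrite mulr_sumr.
    by apply: eq_bigr => i _; rewrite !(adjq_sym H i); ring.
  rewrite !E esum_extension -addrA -big_split; congr (_ + _); apply: eq_bigr => k _ /=.
  ring.
rewrite -[tsum G F]/(t1 G G G) -[tsum H F]/(t1 H H H) S1 S2 S3 -!addrA.
congr (_ + _); rewrite -!big_split; apply: eq_bigr => k _ /=; ring.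
Qed.

End Extension.

(** * Separating two vertices in symmetric sums *)

Section Splitting.
Variables u v : T.
Hypothesis uv : u != v.

Lemma sum_split1 (F : T -> rat) :
  \sum_i F i = F u + F v + \sum_(i | (i != u) && (i != v)) F i.
Proof. by rewrite (bigD1 u) //= (bigD1 v) ?addrA // eq_sym. Qed.

Lemma sum_split2 (F : T -> T -> rat) : (forall i j, F i j = F j i) ->
  \sum_i \sum_j F i j = F u u + F v v + 2 * F u v
    + 2 * (\sum_(j | (j != u) && (j != v)) (F u j + F v j))
    + \sum_(i | (i != u) && (i != v)) \sum_(j | (j != u) && (j != v)) F i j.
Proof.
move=> Fs; rewrite sum_split1 !sum_split1 (Fs v u).
under [X in _ + X = _]eq_bigr => i _ do rewrite sum_split1 (Fs i u) (Fs i v).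
by rewrite !big_split /=; ring.
Qed.

(** Triples are sorted by how they meet [u] and [v]: with both present there are 6 placements, with
    one present 3 positions. Triples with a repeated entry contribute 0. *)
Lemma sum_split3 (F : T -> T -> T -> rat) :
    (forall i j k, F i j k = F j i k) -> (forall i j k, F i j k = F i k j) ->
    (forall i k, F i i k = 0) ->
  \sum_i \sum_j \sum_k F i j k =
    6 * (\sum_(k | (k != u) && (k != v)) F u v k)
    + 3 * (\sum_(j | (j != u) && (j != v)) \sum_(k | (k != u) && (k != v))
        (F u j k + F v j k))
    + \sum_(i | (i != u) && (i != v)) \sum_(j | (j != u) && (j != v))
        \sum_(k | (k != u) && (k != v)) F i j k.
Proof.
move=> F1 F2 F0.
have F0' i k : F i k k = 0 by rewrite F1 F2 F0.
have F0'' i k : F i k i = 0 by rewrite F2 F0.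
have S i : \sum_j \sum_k F i j k = F i u u + F i v v + 2 * F i u v
    + 2 * (\sum_(j | (j != u) && (j != v)) (F i u j + F i v j))
    + \sum_(j | (j != u) && (j != v)) \sum_(k | (k != u) && (k != v)) F i j k.
  by apply: sum_split2 => j k; rewrite F2.
under eq_bigr => i _ do rewrite S !F0' !add0r.
rewrite sum_split1 !F0 F0'' !mulr0 !add0r.
under [\sum_(j | _) (F u u j + F u v j)]eq_bigr => j _ do rewrite F0 add0r.
under [\sum_(j | _) (F v u j + F v v j)]eq_bigr => j _ do rewrite F0 F1 addr0.
rewrite !big_split /= -!mulr_sumr.
under [\sum_(i | _) F i u v]eq_bigr => i _ do rewrite F1 F2.
under [\sum_(i | _) \sum_(j | _) (F i u j + F i v j)]eq_bigr => i _.
  under eq_bigr => j _ do rewrite (F1 i u) (F1 i v).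
  over.
under [\sum_(i | _) \sum_(j | _) (F u i j + F v i j)]eq_bigr => i _ do rewrite big_split /=.
rewrite !big_split /=; ring.
Qed.

Lemma sum_restrict (F : T -> rat) : F u = 0 -> F v = 0 ->
  \sum_(i | (i != u) && (i != v)) F i = \sum_i F i.
Proof. by move=> Fu Fv; rewrite sum_split1 Fu Fv !add0r. Qed.

End Splitting.

(** * Adjacency sums of a contraction *)

Section ContractionSums.
Variables (H : sgraph T) (u v : T).
Hypotheses (uv : u != v) (Huv : ~~ H u v).

Let p := adjq H u.
Let q := adjq H v.
(** Indicator of N(u) U N(v), the neighbourhood of the merged vertex, by inclusion-exclusion. *)
Let z k := p k + q k - p k * q k.

Let puv : p v = 0. Proof. by rewrite /p /adjq (negbTE Huv). Qed.
Let puu : p u = 0. Proof. exact: adjq_diag. Qed.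
Let qvv : q v = 0. Proof. exact: adjq_diag. Qed.
Let qvu : q u = 0. Proof. by rewrite /q adjq_sym. Qed.

Lemma adjq_contract_old i j : (i != u) && (i != v) -> (j != u) && (j != v) ->
  adjq (contract H u v) i j = adjq H i j.
Proof.
move=> /andP[/negbTE iu iv] /andP[/negbTE ju jv].
rewrite /adjq /= /contract_rel /= iv jv iu ju /= !orbF.
by case: (eqVneq i j) => [->|//]; rewrite adj_irr.
Qed.

Lemma adjq_contract_new j : (j != u) && (j != v) ->
  adjq (contract H u v) u j = z j.
Proof.
move=> /andP[ju jv].
rewrite /adjq /= /contract_rel /= uv jv eqxx (eq_sym u) ju (negbTE ju) orbF /=.
by rewrite /z /p /q /adjq; case: (H u j); case: (H v j) => //=; ring.
Qed.

Lemma adjq_contract_isolated j : adjq (contract H u v) v j = 0.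
Proof. by rewrite /adjq /= /contract_rel /= eqxx andbF. Qed.

(** Two weights, because contraction changes the restraint as well; they are compared only away from
    [u] and [v]. *)
Lemma esum_contract (F F' : T -> T -> rat) :
    (forall i j, F i j = F j i) -> (forall i j, F' i j = F' j i) ->
    (forall i j, (i != u) && (i != v) -> (j != u) && (j != v) -> F' i j = F i j) ->
  esum (contract H u v) F' = esum H F
    + 2 * (\sum_(k | (k != u) && (k != v)) (z k * F' u k - p k * F u k - q k * F v k)).
Proof.
move=> Fs F's FF'.
rewrite /esum !(sum_split2 uv) ?adjq_diag ?adjq_contract_isolated; first last.
- by move=> i j; rewrite F's adjq_sym.
- by move=> i j; rewrite Fs adjq_sym.
rewrite [adjq _ u v]adjq_sym adjq_contract_isolated -/(p _) puv.
under eq_bigr => j jP do rewrite adjq_contract_new // adjq_contract_isolated mul0r addr0.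
under [X in _ + X = _]eq_bigr => i iP.
  under eq_bigr => j jP do rewrite adjq_contract_old // FF' //.
  over.
rewrite !big_split /= !sumrN; ring.
Qed.

(** Triangles at the merged vertex replace those at [u] and those at [v]; no triangle of [H]
    contains both. The factor 3 is the position of the special vertex in an ordered triple. *)
Lemma tsum_contract : tsum (contract H u v) (fun _ _ _ => 1) =
  tsum H (fun _ _ _ => 1)
    + 3 * (\sum_i \sum_j adjq H i j * (z i * z j - p i * p j - q i * q j)).
Proof.
have sym3 K i j k : adjq K i j * adjq K i k * adjq K j k * 1 =
    adjq K j i * adjq K j k * adjq K i k * 1.
  by rewrite (adjq_sym K j i); ring.
have sym3' K i j k : adjq K i j * adjq K i k * adjq K j k * 1 =
    adjq K i k * adjq K i j * adjq K k j * 1.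
  by rewrite (adjq_sym K k j); ring.
have diag3 K i k : adjq K i i * adjq K i k * adjq K i k * 1 = 0 by rewrite adjq_diag; ring.
(* [p], [q] and [z] all vanish at [u] and [v], so restricting the range costs nothing. *)
have -> : \sum_i \sum_j adjq H i j * (z i * z j - p i * p j - q i * q j) =
    \sum_(i | (i != u) && (i != v)) \sum_(j | (j != u) && (j != v))
      adjq H i j * (z i * z j - p i * p j - q i * q j).
  rewrite -(sum_restrict uv).
  - apply: eq_bigr => i _; rewrite -(sum_restrict uv) //.
    + by rewrite /z puu qvu; ring.
    + by rewrite /z puv qvv; ring.
  - by rewrite big1 // => j _; rewrite /z puu qvu; ring.
  - by rewrite big1 // => j _; rewrite /z puv qvv; ring.
rewrite /tsum !(sum_split3 uv) //.
rewrite [X in 6 * X]big1; last first.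
  by move=> k _; rewrite [adjq _ u v]adjq_sym adjq_contract_isolated; ring.
rewrite [X in 6 * X + _ + _ + _]big1; last first.
  by move=> k _; rewrite -/(p v) puv; ring.
under [\sum_(j | _) \sum_(k | _) (adjq (contract H u v) u j * _ * _ * _ + _)]eq_bigr => j jP.
  under eq_bigr => k kP do rewrite !adjq_contract_new // adjq_contract_old //
     !adjq_contract_isolated !mul0r addr0.
  over.
under [X in _ + X = _]eq_bigr => i iP.
  under eq_bigr => j jP.
    under eq_bigr => k kP do rewrite !adjq_contract_old //.
    over.
  over.
rewrite mulr0 !add0r [RHS]addrAC -mulrDr -big_split; congr (_ * _ + _).
apply: eq_bigr => j _; rewrite -big_split; apply: eq_bigr => k _ /=.
by rewrite -!/(p _) -!/(q _); ring.
Qed.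

End ContractionSums.
End GraphSums.

(** * Cliques *)

Section Cliques.
Variable T : finType.
Implicit Types (G H : sgraph T) (u v : T) (W D : {set T}).

Definition clique G W := [forall x in W, forall y in W, (x != y) ==> G x y].

Definition n_cliques G k := #|[set W : {set T} | (#|W| == k) && clique G W]|.

Lemma cliqueP G W :
  reflect (forall x y, x \in W -> y \in W -> x != y -> G x y) (clique G W).
Proof.
apply: (iffP forall_inP) => [h x y xW yW xy|h x xW].
  by have /forall_inP/(_ y yW) := h x xW; rewrite xy.
by apply/forall_inP => y yW; apply/implyP; apply: h.
Qed.

Lemma cliqueU1 G x W : x \notin W ->
  clique G (x |: W) = clique G W && [forall y in W, G x y].
Proof.
move=> xW; apply/cliqueP/andP => [h|[/cliqueP h /forall_inP hx] y z].
  split; first by apply/cliqueP => y z yW zW; apply: h; rewrite !inE ?yW ?zW orbT.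
  apply/forall_inP => y yW; apply: h; rewrite ?inE ?eqxx ?yW ?orbT //.
  by apply: contraNneq xW => ->.
rewrite !inE => /orP[/eqP->|yW] /orP[/eqP->|zW]; rewrite ?eqxx // => yz.
- exact: hx.
- by rewrite adj_sym; apply: hx.
- exact: h.
Qed.

Lemma forall_setU1 (P : pred T) x W :
  [forall y in x |: W, P y] = P x && [forall y in W, P y].
Proof.
apply/forall_inP/andP => [h|[Px /forall_inP h] y].
  by split; [apply: h; rewrite setU11|apply/forall_inP => y yW; apply: h; rewrite inE yW orbT].
by rewrite !inE => /orP[/eqP->|/h].
Qed.

Lemma clique2 G u v : u != v -> clique G [set u; v] = G u v.
Proof.
move=> uv; rewrite cliqueU1 ?inE //.
have -> : clique G [set v] by apply/cliqueP => x y; rewrite !inE => /eqP-> /eqP->; rewrite eqxx.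
apply/forall_inP/idP => [h|uvG y]; first by apply: h; rewrite inE.
by rewrite inE => /eqP->.
Qed.

Lemma forall_set2 (P : pred T) u v : [forall y in [set u; v], P y] = P u && P v.
Proof.
rewrite forall_setU1; congr (_ && _); apply/forall_inP/idP => [h|Pv y].
  by apply: h; rewrite inE.
by rewrite inE => /eqP->.
Qed.

Lemma induced_subgraph_inj G : injective (induced_subgraph G).
Proof. by move=> W W' []. Qed.

Lemma imset_set2 (U : finType) (f : U -> T) i j : f @: [set i; j] = [set f i; f j].
Proof. by rewrite imsetU1 imset_set1. Qed.

(** A copy of a complete graph contains all edges between its vertices, so it is the induced
    subgraph on a clique and is determined by its vertex set. *)
Lemma n_subgraphs_complete G k : n_subgraphs G (complete_graph k) = n_cliques G k.
Proof.
rewrite /n_cliques -(card_imset _ (@induced_subgraph_inj G)).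
apply: eq_card => -[W F]; rewrite inE; apply/andP/imsetP.
  move=> [/andP[/= /subsetP Fe /forall_inP FW]].
  move=> /existsP[f /and3P[/= /injectiveP finj /eqP fW /eqP fF]].
  have inW x : x \in W -> exists i, x = f i.
    by rewrite -fW => /imsetP[i _ ->]; exists i.
  exists W.
    rewrite inE -fW card_imset // cardsT card_ord eqxx fW; apply/cliqueP => x y.
    move=> /inW[i ->] /inW[j ->] fij; rewrite -in_edges -imset_set2; apply: Fe.
    rewrite -fF; apply: imset_f; rewrite in_edges /=.
    by apply: contraNneq fij => ->.
  congr (_, _); apply/setP => e; rewrite inE; apply/idP/andP => [eF|[]].
    by rewrite Fe ?FW.
  move=> /edgesP[x [y [xy ->]]] /subsetP eW.
  have /inW[i xi] := eW x (set21 _ _); have /inW[j yj] := eW y (set22 _ _).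
  rewrite -fF xi yj -imset_set2; apply: imset_f; rewrite in_edges /=.
  by have := adj_neq xy; rewrite xi yj; apply: contraNneq => ->.
move=> [W']; rewrite inE => /andP[/eqP Wk /cliqueP cW] [-> ->] {W F}.
split; first apply/andP; first split.
- by apply/subsetP => e; rewrite inE => /andP[].
- by apply/forall_inP => e; rewrite inE => /andP[].
pose f : {ffun 'I_k -> T} := [ffun i => enum_val (cast_ord (esym Wk) i)].
have finj : injective f.
  by move=> i j; rewrite !ffunE => /enum_val_inj/cast_ord_inj.
have fW : f @: [set: 'I_k] = W'.
  apply/setP => x; apply/imsetP/idP => [[i _ ->]|xW]; first by rewrite ffunE enum_valP.
  exists (cast_ord Wk (enum_rank_in xW x)) => //.
  by rewrite ffunE cast_ordK enum_rankK_in.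
apply/existsP; exists f; apply/and3P; split; [exact/injectiveP|exact/eqP|].
apply/eqP/setP => e; rewrite inE; apply/imsetP/andP => [[e']|[]].
  move=> /edgesP[i [j [ij ->]]] ->; rewrite imset_set2 in_edges.
  have inW l : f l \in W' by rewrite -fW imset_f.
  split; first by apply: cW; rewrite ?inW // (inj_eq finj).
  by rewrite subUset !sub1set !inW.
move=> /edgesP[x [y [xy ->]]] /subsetP; rewrite -fW => eW.
have /imsetP[i _ xi] := eW x (set21 _ _); have /imsetP[j _ yj] := eW y (set22 _ _).
exists [set i; j]; last by rewrite imset_set2 xi yj.
by rewrite in_edges /=; have := adj_neq xy; rewrite xi yj; apply: contraNneq => ->.
Qed.

Lemma n_subgraphs_triangle G : n_subgraphs G (cycle_graph 3) = n_cliques G 3.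
Proof.
rewrite -n_subgraphs_complete.
have E : edges (cycle_graph 3) = edges (complete_graph 3).
  apply/setP => e; apply/imsetP/imsetP => -[p]; rewrite inE /= => pe ->; exists p => //;
    rewrite inE /=; move: pe; case: p => -[[|[|[|i]]] hi] [[|[|[|j]]] hj] //.
by rewrite /n_subgraphs /subgraph_iso E.
Qed.

(** Double counting of pairs of a set [W] and a vertex [x] of [W] outside [D]. *)
Lemma sum_supsets (f : {set T} -> rat) D k :
  (k%:R - #|D|%:R) * (\sum_(W : {set T} | (D \subset W) && (#|W| == k)) f W) =
  \sum_(x | x \notin D) \sum_(W : {set T} | (x |: D \subset W) && (#|W| == k)) f W.
Proof.
rewrite (exchange_big_dep (fun W : {set T} => (D \subset W) && (#|W| == k))) /=; last first.
  by move=> x W xD /andP[]; rewrite subUset => /andP[_ ->].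
rewrite mulr_sumr; apply: eq_bigr => W /andP[DW Wk].
rewrite (eq_bigl (fun x => x \in W :\: D)); last first.
  by move=> x; rewrite inE subUset sub1set DW Wk !andbT.
rewrite sumr_const -[RHS]mulr_natl; congr (_ * _).
rewrite cardsD (setIidPr DW) natrB ?subset_leq_card //.
by rewrite (eqP Wk).
Qed.

Lemma sum_supsets_card (f : {set T} -> rat) D :
  \sum_(W : {set T} | (D \subset W) && (#|W| == #|D|)) f W = f D.
Proof.
rewrite (big_pred1 D) // => W /=; apply/andP/eqP => [[DW /eqP WD]|->]; last by rewrite subxx.
by apply/esym/eqP; rewrite eqEcard DW WD /=.
Qed.

Lemma sum_supsets3 (f : {set T} -> rat) u v : u != v ->
  \sum_(W : {set T} | ([set u; v] \subset W) && (#|W| == 3%N)) f W =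
  \sum_(x | x \notin [set u; v]) f (x |: [set u; v]).
Proof.
move=> uv; have := sum_supsets f [set u; v] 3; rewrite cards2 uv.
have -> : 3%:R - 2%:R = 1 :> rat by [].
rewrite mul1r => ->; apply: eq_bigr => x xuv.
by rewrite -[RHS](sum_supsets_card f) cardsU1 xuv cards2 uv.
Qed.

(** The factor 2 is the order in which the two further vertices are added. *)
Lemma sum_supsets4 (f : {set T} -> rat) u v : u != v ->
  2 * (\sum_(W : {set T} | ([set u; v] \subset W) && (#|W| == 4%N)) f W) =
  \sum_(x | x \notin [set u; v]) \sum_(y | y \notin x |: [set u; v])
    f (y |: (x |: [set u; v])).
Proof.
move=> uv; have := sum_supsets f [set u; v] 4; rewrite cards2 uv.
have -> : 4%:R - 2%:R = 2 :> rat by [].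
move=> ->; apply: eq_bigr => x xuv.
have := sum_supsets f (x |: [set u; v]) 4; rewrite cardsU1 xuv cards2 uv.
have -> : 4%:R - (true + (true.+1))%:R = 1 :> rat by [].
rewrite mul1r => ->; apply: eq_bigr => y yuv.
by rewrite -[RHS](sum_supsets_card f) cardsU1 yuv cardsU1 xuv cards2 uv.
Qed.

Lemma n_cliques_sum G k :
  (n_cliques G k)%:R = \sum_(W : {set T} | #|W| == k) (clique G W)%:R :> rat.
Proof.
rewrite /n_cliques -sum1_card natr_sum big_mkcond [RHS]big_mkcond /=.
by apply: eq_bigr => W _; rewrite inE; case: (#|W| == k); case: (clique G W).
Qed.

Lemma n_cliques_edgeless G k : (forall i j, ~~ G i j) -> (1 < k)%N -> n_cliques G k = 0%N.
Proof.
move=> G0 k1; apply/eqP; rewrite cards_eq0; apply/eqP/setP => W; rewrite !inE.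
apply/andP => -[/eqP Wk /cliqueP cW].
have /card_gt1P[x [y [xW yW xy]]] : (1 < #|W|)%N by rewrite Wk.
by have := G0 x y; rewrite (cW x y).
Qed.

(** * Cliques created by a new edge *)

Section CliqueExtension.
Variables (H G : sgraph T) (u v : T).
Hypothesis ext : edge_extension H G u v.

Let uv : u != v := extension_neq ext.
Let Guv : G u v := extension_adj ext.
Let Huv : H u v = false := extension_nadj ext.
Let GH := extension_old ext.

Lemma adj_extension_subset (W : {set T}) i j : ~~ ([set u; v] \subset W) ->
  i \in W -> j \in W -> G i j = H i j.
Proof.
case: ext => _ _ -> uvW iW jW.
have h x y : x \in W -> y \in W -> (x == u) && (y == v) = false.
  move=> xW yW; apply/negP => /andP[/eqP xu /eqP yv]; case/negP: uvW.
  by rewrite subUset !sub1set -xu -yv xW yW.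
by rewrite h // (andbC (i == v)) h // !orbF.
Qed.

(** A set containing both ends is never a clique of [H]; on any other set [G] and [H] agree. *)
Lemma n_cliques_extension k : (n_cliques G k)%:R = (n_cliques H k)%:R +
  \sum_(W : {set T} | ([set u; v] \subset W) && (#|W| == k)) (clique G W)%:R :> rat.
Proof.
rewrite !n_cliques_sum.
rewrite (bigID (fun W : {set T} => [set u; v] \subset W)) /=.
rewrite [in RHS](bigID (fun W : {set T} => [set u; v] \subset W)) /=.
rewrite [X in _ = X + _ + _]big1 ?add0r; last first.
  move=> W /andP[_ /subsetP uvW]; case: cliqueP => // cW.
  by have := cW u v (uvW u (set21 _ _)) (uvW v (set22 _ _)) uv; rewrite Huv.
rewrite addrC; congr (_ + _); last by apply: eq_bigl => W; rewrite andbC.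
apply: eq_bigr => W /andP[_ uvW]; congr (nat_of_bool _)%:R.
by apply/cliqueP/cliqueP => cW x y xW yW xy; have := cW x y xW yW xy;
  rewrite (adj_extension_subset uvW).
Qed.

Lemma n_cliques3_extension : (n_cliques G 3)%:R = (n_cliques H 3)%:R +
  \sum_k adjq H u k * adjq H v k :> rat.
Proof.
rewrite n_cliques_extension sum_supsets3 //; congr (_ + _).
rewrite [RHS](bigID (fun x => x \notin [set u; v])) /= [X in _ = _ + X]big1 ?addr0.
  apply: eq_bigr => x xuv.
  by rewrite cliqueU1 // clique2 // Guv forall_set2 /adjq -natrM mulnb !GH // !(adj_sym H x).
move=> x; rewrite negbK !inE => /orP[] /eqP->; rewrite ?adjq_diag ?mul0r //.
by rewrite /adjq Huv mul0r.
Qed.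

Lemma n_cliques4_extension : (n_cliques G 4)%:R = (n_cliques H 4)%:R +
  1 / 2 * (\sum_i \sum_j adjq H i j *
     (adjq H u i * adjq H u j * (adjq H v i * adjq H v j))) :> rat.
Proof.
rewrite n_cliques_extension; congr (_ + _).
have := sum_supsets4 (fun W => (clique G W)%:R) uv.
rewrite /=; set S := \sum_(W | _) _ => E.
have -> : S = 1 / 2 * (2 * S) by field.
rewrite {}E; congr (_ * _).
have p0 x : x \in [set u; v] -> adjq H u x * adjq H v x = 0.
  rewrite !inE => /orP[] /eqP->; rewrite ?adjq_diag ?mul0r //.
  by rewrite /adjq Huv mul0r.
rewrite [RHS](bigID (fun x => x \notin [set u; v])) /= [X in _ = _ + X]big1 ?addr0; last first.
  move=> x; rewrite negbK => /p0 x0; rewrite big1 // => y _.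
  by rewrite mulrACA x0 mul0r mulr0.
apply: eq_bigr => x xuv.
rewrite [RHS](bigID (fun y => y \notin x |: [set u; v])) /= [X in _ = _ + X]big1 ?addr0; last first.
  move=> y; rewrite negbK !inE => /orP[/eqP->|]; first by rewrite adjq_diag mul0r.
  rewrite -in_set2 => /p0 y0; by rewrite mulrACA y0 !mulr0.
apply: eq_bigr => y yuv; rewrite cliqueU1 // cliqueU1 // clique2 // Guv
  forall_set2 forall_setU1 forall_set2.
have yuv' : y \notin [set u; v] by move: yuv; rewrite in_setU1 negb_or => /andP[].
rewrite /adjq -!natrM !mulnb !GH // (adj_sym H y x) !(adj_sym H x u) !(adj_sym H x v)
  !(adj_sym H y u) !(adj_sym H y v).
by congr (nat_of_bool _)%:R; case: (H u x); case: (H v x);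
  case: (H x y); case: (H u y); case: (H v y).
Qed.

End CliqueExtension.

(** Edge induction replaces a count of the six orderings: both sides grow by the number of common
    neighbours. *)
Lemma n_cliques3 G : (n_cliques G 3)%:R = 1 / 6 * tsum G (fun _ _ _ => 1) :> rat.
Proof.
elim/sgraph_ind: G => [G G0|H G u v ext IH].
  by rewrite n_cliques_edgeless // tsum0 // mulr0.
rewrite (n_cliques3_extension ext) (tsum_extension ext) IH mulrDr; congr (_ + _).
by rewrite -mulr_suml; field.
Qed.

Lemma nedges_esum G : (nedges G)%:R = 1 / 2 * esum G (fun _ _ => 1) :> rat.
Proof.
elim/sgraph_ind: G => [G G0|H G u v ext IH].
  by rewrite nedges0 // esum0 // mulr0.
by rewrite (nedges_extension ext) (esum_extension ext) -addn1 natrD IH; field.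
Qed.

End Cliques.

(** * Induced four-cycles *)

Section InducedFourCycles.
Variable T : finType.
Implicit Types (G H : sgraph T) (u v : T) (W : {set T}).

(** Since [f] is injective, so is its action on sets; equality of edge sets therefore says that [f]
    preserves and reflects adjacency. *)
Lemma induced_isoP G W (U : finType) (K : sgraph U) :
  reflect (exists f : {ffun U -> T}, [/\ injective f, f @: [set: U] = W &
             forall i j, K i j = G (f i) (f j)])
          (subgraph_iso (induced_subgraph G W) K).
Proof.
apply: (iffP existsP) => -[f].
  case/and3P => /injectiveP finj /= /eqP fW /eqP fK; exists f; split=> // i j.
  have inW l : f l \in W by rewrite -fW imset_f.
  rewrite -[LHS]in_edges -(mem_imset _ _ (imset_inj finj)) fK inE imset_set2 in_edges.
  by rewrite subUset !sub1set !inW !andbT.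
case=> finj fW fK; exists f; apply/and3P; split; [exact/injectiveP|exact/eqP|].
apply/eqP/setP => e; rewrite inE; apply/imsetP/andP => [[e']|[]].
  move=> /edgesP[i [j [ij ->]]] ->; rewrite imset_set2 in_edges -fK ij.
  by rewrite subUset !sub1set -fW !imset_f.
move=> /edgesP[x [y [xy ->]]] /subsetP; rewrite -fW => eW.
have /imsetP[i _ xi] := eW x (set21 _ _); have /imsetP[j _ yj] := eW y (set22 _ _).
by exists [set i; j]; rewrite ?imset_set2 ?in_edges ?fK -?xi -?yj.
Qed.

Definition four_cycle G (p q r s : T) :=
  [&& G p q, G q r, G r s, G s p, ~~ G p r & ~~ G q s].

Lemma induced_four_cycleP G W :
  reflect (exists p q r s, [/\ uniq [:: p; q; r; s], W = [set p; q; r; s] &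
             four_cycle G p q r s])
          (subgraph_iso (induced_subgraph G W) (cycle_graph 4)).
Proof.
pose o k (lt : (k < 4)%N) : 'I_4 := Ordinal lt.
pose o0 := @o 0 isT; pose o1 := @o 1%N isT; pose o2 := @o 2%N isT; pose o3 := @o 3%N isT.
have o_all (P : 'I_4 -> Prop) : P o0 -> P o1 -> P o2 -> P o3 -> forall i, P i.
  move=> P0 P1 P2 P3 [[|[|[|[|i]]]] lt] //; by rewrite (bool_irrelevance lt isT).
apply: (iffP (induced_isoP _ _ _)) =>
  [[f [finj fW fG]]|[p [q [r [s [Hu -> /and5P[pq qr rs sp /andP[pr qs]]]]]]]].
  exists (f o0), (f o1), (f o2), (f o3); split.
  - by rewrite /= !inE !(inj_eq finj).
  - rewrite -fW; apply/setP => x; rewrite !inE; apply/imsetP/idP => [[i _ ->]|].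
      by move: i; apply: o_all; rewrite !eqxx ?orbT.
    by rewrite -!orbA => /or4P[] /eqP->; eexists.
  - by rewrite /four_cycle -!fG.
pose f : {ffun 'I_4 -> T} := [ffun i => nth p [:: p; q; r; s] (val i)].
exists f; split.
- move=> i j; rewrite !ffunE => /eqP; rewrite nth_uniq ?ltn_ord // => /eqP.
  exact: val_inj.
- apply/setP => x; rewrite !inE -!orbA; apply/imsetP/idP => [[i _ ->]|].
    by move: i; apply: o_all; rewrite ffunE /= !eqxx ?orbT.
  by case/or4P => /eqP->; [exists o0|exists o1|exists o2|exists o3]; rewrite ?ffunE.
- apply: (o_all); apply: (o_all); rewrite !ffunE /=
    ?adj_irr ?pq ?qr ?rs ?sp ?(negbTE pr) ?(negbTE qs) //;
    rewrite adj_sym ?adj_irr ?pq ?qr ?rs ?sp ?(negbTE pr) ?(negbTE qs) //.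
Qed.

(** Four vertices have three cyclic orders, told apart by the vertex opposite to [u]: here [x], [y]
    and [v] in turn. *)
Lemma induced_four_cycle_set4 G u v x y : uniq [:: u; v; x; y] ->
  subgraph_iso (induced_subgraph G (y |: (x |: [set u; v]))) (cycle_graph 4) =
  [|| four_cycle G u v x y, four_cycle G u v y x | four_cycle G u x v y].
Proof.
move=> Hu; apply/induced_four_cycleP/idP.
  move=> [p [q [r [s [Hu' /setP E]]]]] /and5P[pq qr rs sp /andP[/negbTE pr /negbTE qs]].
  have := E u; have := E v; have := E x; have := E y; rewrite !inE !eqxx ?orbT -!orbA {E}.
  have rp : G r p = false by rewrite adj_sym.
  have sq : G s q = false by rewrite adj_sym.
  have qp : G q p by rewrite adj_sym.
  have rq : G r q by rewrite adj_sym.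
  have sr : G s r by rewrite adj_sym.
  have ps : G p s by rewrite adj_sym.
  rewrite /four_cycle.
  (* All assignments of [u], [v], [x], [y] to positions on the cycle are tried; distinctness leaves
     the 24 permutations. *)
  do 4![move/esym/or4P => [] /eqP ?]; subst; move: Hu; rewrite /= !inE ?eqxx ?orbT ?andbF //= => _;
  by rewrite ?pq ?qr ?rs ?sp ?pr ?qs ?rp ?sq ?qp ?rq ?sr ?ps.
have perm4 p q r s : perm_eq [:: p; q; r; s] [:: u; v; x; y] ->
    uniq [:: p; q; r; s] /\ y |: (x |: [set u; v]) = [set p; q; r; s].
  move=> pe; split; first by rewrite (perm_uniq pe).
  apply/setP => t; have := perm_mem pe t; rewrite !inE -!orbA => ->.
  by case: (t == u); case: (t == v); case: (t == x); case: (t == y).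
case/or3P => h.
- by exists u, v, x, y; have [] := perm4 u v x y (perm_refl _).
- exists u, v, y, x; have [|? ?] := perm4 u v y x; last by split.
  by rewrite !perm_cons (perm_catC [:: y] [:: x]).
- exists u, x, v, y; have [|? ?] := perm4 u x v y; last by split.
  by rewrite perm_cons (perm_catCA [:: x] [:: v] [:: y]).
Qed.

Lemma n_induced_sum G (U : finType) (K : sgraph U) : (n_induced G K)%:R =
  \sum_(W : {set T}) (subgraph_iso (induced_subgraph G W) K)%:R :> rat.
Proof.
rewrite /n_induced -sum1_card natr_sum big_mkcond /=.
by apply: eq_bigr => W _; rewrite inE; case: (subgraph_iso _ _).
Qed.

Lemma n_induced_four_cycle_edgeless G : (forall i j, ~~ G i j) ->
  n_induced G (cycle_graph 4) = 0%N.
Proof.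
move=> G0; apply/eqP; rewrite cards_eq0; apply/eqP/setP => W; rewrite !inE.
by apply/induced_four_cycleP => -[p [q [r [s [_ _ /and5P[]]]]]]; rewrite (negbTE (G0 p q)).
Qed.

(** * Induced four-cycles created and destroyed by a new edge *)

Section FourCycleExtension.
Variables (H G : sgraph T) (u v : T).
Hypothesis ext : edge_extension H G u v.

Let uv : u != v := extension_neq ext.
Let Guv : G u v := extension_adj ext.
Let Huv : H u v = false := extension_nadj ext.
Let GH := extension_old ext.
Let GH' := extension_old_r ext.

Let p := adjq H u.
Let q := adjq H v.
Let d := \sum_k p k * q k.

(** The first two terms are the new cycles [u v x y] and [u v y x]; the last is the old cycle
    [u x v y], to which [uv] becomes a chord. *)
Let four_cycle_change x y : rat :=
  adjq H x y * (q x * (1 - p x) * (p y * (1 - q y)))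
  + adjq H x y * (q y * (1 - p y) * (p x * (1 - q x)))
  - p x * q x * (p y * q y) * (1 - adjq H x y).

Let isoG W := (subgraph_iso (induced_subgraph G W) (cycle_graph 4))%:R : rat.
Let isoH W := (subgraph_iso (induced_subgraph H W) (cycle_graph 4))%:R : rat.

Lemma iso_extension x y : x \notin [set u; v] -> y \notin x |: [set u; v] ->
  isoG (y |: (x |: [set u; v])) - isoH (y |: (x |: [set u; v])) = four_cycle_change x y.
Proof.
move=> xuv yuv.
have yuv' : y \notin [set u; v] by move: yuv; rewrite in_setU1 negb_or => /andP[].
have Hu : uniq [:: u; v; x; y].
  move: xuv yuv; rewrite /= !inE !negb_or => /andP[xu xv] /and3P[yx yu yv].
  by rewrite uv !(eq_sym _ x) !(eq_sym _ y) xu xv yx yu yv.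
rewrite /isoG /isoH !induced_four_cycle_set4 // /four_cycle Guv Huv.
rewrite !(GH _ xuv) !(GH _ yuv') !(GH' _ xuv) !(GH' _ yuv').
rewrite ?(adj_sym H x u) ?(adj_sym H y u) ?(adj_sym H x v) ?(adj_sym H y v) ?(adj_sym H y x).
rewrite /four_cycle_change /p /q /adjq.
by case: (H u x); case: (H u y); case: (H v x); case: (H v y); case: (H x y).
Qed.

(** [(d ^+ 2 - d) / 2] counts pairs of common neighbours, and half of the last sum counts those
    joined by an edge; the difference is the number of destroyed cycles. The first double sum has no
    factor 1/2, since its two indices play different roles. *)
Lemma n_induced_four_cycle_extension :
  (n_induced G (cycle_graph 4))%:R = (n_induced H (cycle_graph 4))%:R
   + \sum_i \sum_j adjq H i j * (q i * (1 - p i) * (p j * (1 - q j)))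
   - (d ^+ 2 - d) / 2
   + 1 / 2 * (\sum_i \sum_j adjq H i j * (p i * p j * (q i * q j))) :> rat.
Proof.
have pq0 x : x \in [set u; v] -> (p x = 0) * (q x = 0).
  rewrite !inE /p /q /adjq => /orP[] /eqP->; rewrite ?adj_irr ?Huv //.
  by rewrite adj_sym Huv.
have -> : (n_induced G (cycle_graph 4))%:R = (n_induced H (cycle_graph 4))%:R +
    \sum_(W : {set T} | ([set u; v] \subset W) && (#|W| == 4%N)) (isoG W - isoH W).
  rewrite !n_induced_sum; apply/eqP; rewrite addrC -subr_eq -sumrB.
  rewrite (bigID (fun W : {set T} => ([set u; v] \subset W) && (#|W| == 4%N))) /=.
  rewrite [X in _ + X]big1 ?addr0 // => W; rewrite negb_and => /orP[uvW|W4].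
    have -> : induced_subgraph G W = induced_subgraph H W; last by rewrite subrr.
    congr (_, _); apply/setP => e; rewrite !inE; apply/andP/andP => -[/edgesP[i [j [ij ->]]] eW];
      split=> //; move: ij; have := eW; rewrite subUset !sub1set => /andP[iW jW];
      by rewrite in_edges (adj_extension_subset ext uvW).
  have W0 K : subgraph_iso (induced_subgraph K W) (cycle_graph 4) = false.
    apply/induced_isoP => -[f [finj fW _]]; case/negP: W4.
    by rewrite -fW card_imset // cardsT card_ord.
  by rewrite !W0 subrr.
have := sum_supsets4 (fun W => isoG W - isoH W) uv; rewrite /=.
set S := \sum_(W | _) _ => E.
have {E} -> : S = 1 / 2 * (\sum_i \sum_(j | j != i) four_cycle_change i j).
  have -> : S = 1 / 2 * (2 * S) by field.
  rewrite {}E; congr (_ * _).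
  rewrite [RHS](bigID (fun x => x \notin [set u; v])) /= [X in _ = _ + X]big1 ?addr0; last first.
    move=> x; rewrite negbK => /pq0 x0; rewrite big1 // => y _.
    by rewrite /four_cycle_change !x0; ring.
  apply: eq_bigr => x xuv.
  rewrite [RHS](bigID (fun y => y \notin [set u; v])) /= [X in _ = _ + X]big1 ?addr0; last first.
    by move=> y /andP[_]; rewrite negbK => /pq0 y0; rewrite /four_cycle_change !y0; ring.
  rewrite (eq_bigl (fun y => (y != x) && (y \notin [set u; v]))); last first.
    by move=> y; rewrite in_setU1 negb_or.
  apply: eq_bigr => y /andP[yx yuv]; rewrite iso_extension // in_setU1 negb_or.
  by rewrite yx.
(* On the diagonal the formula gives [- (p i * q i)] although no cycle is involved; [d] compensates
   for this. *)
have -> : \sum_i \sum_(j | j != i) four_cycle_change i j =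
    \sum_i \sum_j four_cycle_change i j + d.
  have -> : d = \sum_i - four_cycle_change i i.
    apply: eq_bigr => i _; rewrite /four_cycle_change adjq_diag.
    have -> : p i * q i * (p i * q i) = (p i * p i) * (q i * q i) by ring.
    by rewrite !adjq_idem; ring.
  rewrite -big_split; apply: eq_bigr => i _ /=.
  by rewrite [in RHS](bigD1 i) //=; ring.
have -> : d ^+ 2 = \sum_i \sum_j p i * q i * (p j * q j).
  by rewrite expr2 mulr_suml; apply: eq_bigr => i _; rewrite mulr_sumr.
set A := \sum_i \sum_j adjq H i j * (q i * (1 - p i) * (p j * (1 - q j))).
set B := \sum_i \sum_j adjq H i j * (p i * p j * (q i * q j)).
set C := \sum_i \sum_j p i * q i * (p j * q j).
have -> : \sum_i \sum_j four_cycle_change i j = A + A - C + B.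
  have A2 : A = \sum_i \sum_j adjq H j i * (q j * (1 - p j) * (p i * (1 - q i))).
    exact: exchange_big.
  rewrite [X in _ = _ + X - _ + _]A2 /A /B /C -!sumrN -!big_split; apply: eq_bigr => i _ /=.
  rewrite -!sumrN -!big_split; apply: eq_bigr => j _ /=.
  by rewrite /four_cycle_change (adjq_sym H j i); ring.
by field.
Qed.

End FourCycleExtension.
End InducedFourCycles.

(** * The coefficients of degree n - 1, n - 2 and n - 3 *)

Section RestraintCards.
Variable T : finType.
Implicit Types (G H : sgraph T) (r : restraint T).

Definition rcard1 r (i : T) : rat := #|` r i|%:R.
Definition rcard2 r (i j : T) : rat := #|` (r i `&` r j)%fset|%:R.
Definition rcard3 r (i j k : T) : rat := #|` (r i `&` r j `&` r k)%fset|%:R.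

Lemma rcard2C r i j : rcard2 r i j = rcard2 r j i.
Proof. by rewrite /rcard2 fsetIC. Qed.

Lemma rcard3C r i j k : rcard3 r i j k = rcard3 r j i k.
Proof. by rewrite /rcard3 (fsetIC (r i)). Qed.

Lemma rcard3CA r i j k : rcard3 r i j k = rcard3 r i k j.
Proof. by rewrite /rcard3 -!fsetIA (fsetIC (r j)). Qed.

Lemma card_fsetU (A B : {fset nat}) :
  #|` (A `|` B)%fset|%:R = #|` A|%:R + #|` B|%:R - #|` (A `&` B)%fset|%:R :> rat.
Proof.
by apply/eqP; rewrite eq_sym subr_eq -!natrD cardfsUI.
Qed.

(** * Restraint sizes after merging two vertices *)

Section Merging.
Variables (r : restraint T) (u v : T).
Hypothesis uv : u != v.

Lemma rcard1_merge_new : rcard1 (merge_restraint r u v) u = rcard1 r u + rcard1 r v - rcard2 r u v.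
Proof. by rewrite /rcard1 /= /merge_fun (negbTE uv) eqxx card_fsetU. Qed.

Lemma rcard1_merge_isolated : rcard1 (merge_restraint r u v) v = 0.
Proof. by rewrite /rcard1 /= /merge_fun eqxx cardfs0. Qed.

Lemma rcard1_merge_old i : (i != u) && (i != v) -> rcard1 (merge_restraint r u v) i = rcard1 r i.
Proof. by case/andP => /negbTE iu /negbTE iv; rewrite /rcard1 /= /merge_fun iu iv. Qed.

Lemma rcard2_merge_old i j : (i != u) && (i != v) -> (j != u) && (j != v) ->
  rcard2 (merge_restraint r u v) i j = rcard2 r i j.
Proof.
case/andP => /negbTE iu /negbTE iv /andP[/negbTE ju /negbTE jv].
by rewrite /rcard2 /= /merge_fun iu iv ju jv.
Qed.

Lemma rcard2_merge_new j : (j != u) && (j != v) ->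
  rcard2 (merge_restraint r u v) u j = rcard2 r u j + rcard2 r v j - rcard3 r u v j.
Proof.
case/andP => /negbTE ju /negbTE jv.
rewrite /rcard2 /rcard3 /= /merge_fun ju jv (negbTE uv) eqxx fsetIUl card_fsetU.
by rewrite fsetIACA fsetIid.
Qed.

(** The condition on [f] deals with [v], whose restraint becomes empty. The uses are the first two
    power sums. *)
Lemma sum_rcard1_merge (f : rat -> rat) : f 0 = 0 ->
  \sum_i f (rcard1 (merge_restraint r u v) i) = \sum_i f (rcard1 r i)
    - f (rcard1 r u) - f (rcard1 r v) + f (rcard1 r u + rcard1 r v - rcard2 r u v).
Proof.
move=> f0; rewrite !(sum_split1 uv) rcard1_merge_new rcard1_merge_isolated f0.
under eq_bigr => i iP do rewrite rcard1_merge_old //.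
ring.
Qed.

End Merging.

Lemma sum_map_enum (f : T -> rat) (g : rat -> rat) :
  \sum_(c <- [seq f i | i <- enum T]) g c = \sum_i g (f i).
Proof. by rewrite big_map big_enum. Qed.

Lemma elemsym_intr k (cs : seq int) : (elemsym k cs)%:~R = elemsym k [seq c%:~R | c <- cs] :> rat.
Proof.
by elim: cs k => [|c cs IH] [|k] //=; rewrite intrD intrM !IH.
Qed.

Lemma acoef_edgeless G r k : (forall i j, ~~ G i j) -> (k <= #|T|)%N ->
  (acoef G r k)%:~R = elemsym k [seq rcard1 r i | i <- enum T] :> rat.
Proof.
move=> G0 kT; rewrite /acoef restrained_poly_edgeless //.
have -> : \prod_(v : T) ('X - (#|` r v|%:Z)%:P) =
    \prod_(c <- [seq #|` r v|%:Z | v <- enum T]) ('X - c%:P).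
  by rewrite big_map big_enum.
rewrite (@coef_prod_XsubC_elemsym _ _ _ k); last by rewrite size_map -cardE subnK.
by rewrite mulrA -exprMn mulrNN mulr1 expr1n mul1r elemsym_intr -map_comp.
Qed.

(** Counts in tuple form, for which the extension and contraction lemmas apply directly; [nedgesE]
    and [trianglesE] relate them to the cardinals of the statement. *)
Definition edgeq G : rat := 1 / 2 * esum G (fun _ _ => 1).
Definition triangleq G : rat := 1 / 6 * tsum G (fun _ _ _ => 1).
Definition overlapq G r : rat := 1 / 2 * esum G (rcard2 r).
Definition rsum1 r : rat := \sum_i rcard1 r i.
Definition rsum2 r : rat := \sum_i rcard1 r i ^+ 2.
Definition rsum3 r : rat := \sum_i rcard1 r i ^+ 3.

(** The two edges to a common neighbour become one. *)
Lemma edges_contract H u v : u != v -> ~~ H u v ->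
  edgeq (contract H u v) = edgeq H - \sum_k adjq H u k * adjq H v k.
Proof.
move=> uv Huv; rewrite /edgeq (@esum_contract _ _ _ _ uv Huv (fun _ _ => 1)) //.
rewrite mulrDr; congr (_ + _).
have -> : \sum_k adjq H u k * adjq H v k =
    \sum_(k | (k != u) && (k != v)) adjq H u k * adjq H v k.
  by rewrite (sum_restrict uv) // adjq_diag ?mul0r ?mulr0.
rewrite -sumrN mulrA [1 / 2 * 2]mulrC divrr ?unitfE // mul1r.
by apply: eq_bigr => k _; ring.
Qed.

Lemma acoef1 G r : (0 < #|T|)%N -> (acoef G r 1)%:~R = edgeq G + rsum1 r :> rat.
Proof.
move=> T0; elim/sgraph_ind: G => [G G0|H G u v ext IH].
  by rewrite acoef_edgeless // /edgeq esum0 // mulr0 add0r elemsym1 (sum_map_enum _ id).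
rewrite (acoef_extension _ ext) // intrD IH acoef0 /edgeq (esum_extension ext).
by field.
Qed.

(** By [acoef1] the contraction adds [edgeq H] less the common neighbours, and [rsum1 r] less the
    overlap at the new edge. Accumulated over all edges these give the binomial, the triangles, the
    product and [overlapq]. *)
Lemma acoef2 G r : (1 < #|T|)%N -> (acoef G r 2)%:~R =
  edgeq G * (edgeq G - 1) / 2 - triangleq G + edgeq G * rsum1 r - overlapq G r
  + (rsum1 r ^+ 2 - rsum2 r) / 2 :> rat.
Proof.
move=> T1; elim/sgraph_ind: G => [G G0|H G u v ext IH].
  rewrite acoef_edgeless // /edgeq /overlapq /triangleq !esum0 // tsum0 //.
  set cs := map _ _; have -> : elemsym 2 cs = (2 * elemsym 2 cs) / 2 by field.
  by rewrite elemsym2 /cs (sum_map_enum _ id) (sum_map_enum _ (fun c => c ^+ 2))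
    -/(rsum1 r) -/(rsum2 r); field.
have [uv Huv _] := ext.
rewrite (acoef_extension _ ext) // intrD IH acoef1 ?(ltnW T1) // edges_contract //.
have -> : rsum1 (merge_restraint r u v) = rsum1 r - rcard2 r u v.
  by rewrite /rsum1 (sum_rcard1_merge _ uv (f := id)) //; ring.
rewrite /edgeq /overlapq /triangleq !(esum_extension ext) (tsum_extension ext) (rcard2C r v u).
by rewrite -mulr_suml; field.
Qed.

(** Grouped like the statement: [A0], then [A1], then [A2] and [A3] together, then [A4] to [A8]. *)
Lemma acoef3 G r : (2 < #|T|)%N -> (acoef G r 3)%:~R =
  edgeq G * (edgeq G - 1) * (edgeq G - 2) / 6 - (edgeq G - 2) * triangleq G
  - (n_induced G (cycle_graph 4))%:R + 2 * (n_cliques G 4)%:R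
  + (rsum1 r ^+ 3 - 3 * rsum1 r * rsum2 r + 2 * rsum3 r) / 6
  + edgeq G * ((rsum1 r ^+ 2 - rsum2 r) / 2) - 1 / 2 * esum G (fun i j => rcard1 r i * rcard1 r j)
  - 1 / 2 * esum G (fun i j => rcard2 r i j * (rsum1 r - rcard1 r i - rcard1 r j))
  + (edgeq G * (edgeq G - 1) / 2 - triangleq G) * rsum1 r
  - (edgeq G - 1) * overlapq G r
  + (1 / 2 * tsum G (fun i j k => rcard2 r i j)
     - 1 / 2 * psum G (fun i j k => (j != k)%:R * rcard2 r j k))
  + (1 / 2 * psum G (fun i j k => (j != k)%:R * rcard3 r i j k)
     - 1 / 6 * tsum G (rcard3 r)) :> rat.
Proof.
move=> T2; elim/sgraph_ind: G => [G G0|H G u v ext IH].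
  rewrite acoef_edgeless // /edgeq /overlapq /triangleq !esum0 // !tsum0 // !psum0 //.
  rewrite n_cliques_edgeless // n_induced_four_cycle_edgeless //.
  set cs := map _ _; have -> : elemsym 3 cs = (6 * elemsym 3 cs) / 6 by field.
  by rewrite elemsym3 /cs (sum_map_enum _ id) (sum_map_enum _ (fun c => c ^+ 2))
    (sum_map_enum _ (fun c => c ^+ 3)) -/(rsum1 r) -/(rsum2 r) -/(rsum3 r); field.
have [uv Huv _] := ext; have Huv0 : adjq H u v = 0 by rewrite /adjq (negbTE Huv).
rewrite (acoef_extension _ ext) // intrD IH acoef2 ?(ltnW T2) // edges_contract //.
rewrite (n_cliques4_extension ext) (n_induced_four_cycle_extension ext).
pose p := adjq H u; pose q := adjq H v; pose z k := p k + q k - p k * q k.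
have pv : p v = 0 by [].
have qu : q u = 0 by rewrite /q adjq_sym.
have pu : p u = 0 by exact: adjq_diag.
have qv : q v = 0 by exact: adjq_diag.
set d := \sum_k p k * q k.
set gam := \sum_i \sum_j adjq H i j * (q i * (1 - p i) * (p j * (1 - q j))).
set kap := \sum_i \sum_j adjq H i j * (p i * p j * (q i * q j)).
(* Increments of the overlap sums: [X1], [X2] (pairs) and [X4], [X5] (triples) belong to the new
   paths centred at [u] and at [v]; [X3] and [X6] belong to the new triangles, [X3] taking their two
   old edges. *)
pose X1 := \sum_k p k * rcard2 r v k.
pose X2 := \sum_k q k * rcard2 r u k.
pose X3 := \sum_k p k * q k * (rcard2 r u k + rcard2 r v k).
pose X4 := \sum_k p k * rcard3 r u v k.
pose X5 := \sum_k q k * rcard3 r u v k.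
pose X6 := \sum_k p k * q k * rcard3 r u v k.
have -> : triangleq (contract H u v) = triangleq H + gam - 1 / 2 * kap.
  rewrite /triangleq (tsum_contract uv Huv).
  (* Splitting N' into N(u) \ N(v), N(v) \ N(u) and N, only pairs between the first two parts
     survive positively. Pairs inside N survive negatively: their triangles were present at both [u]
     and [v] and are now present once. *)
  set Z := \sum_i \sum_j _; have -> : Z = gam + gam - kap.
    have g2 : gam = \sum_i \sum_j adjq H j i * (q j * (1 - p j) * (p i * (1 - q i))).
      exact: exchange_big.
    rewrite [X in _ = _ + X - _]g2 /gam /kap /Z -!sumrN -!big_split; apply: eq_bigr => i _ /=.
    rewrite -!sumrN -!big_split; apply: eq_bigr => j _ /=.
    by rewrite -/p -/q (adjq_sym H j i); ring.
  by field.
have -> : rsum1 (merge_restraint r u v) = rsum1 r - rcard2 r u v.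
  by rewrite /rsum1 (sum_rcard1_merge _ uv (f := id)) //; ring.
have -> : rsum2 (merge_restraint r u v) = rsum2 r - rcard1 r u ^+ 2 - rcard1 r v ^+ 2
    + (rcard1 r u + rcard1 r v - rcard2 r u v) ^+ 2.
  by rewrite /rsum2 (sum_rcard1_merge _ uv (f := fun x => x ^+ 2)) ?expr0n.
have -> : overlapq (contract H u v) (merge_restraint r u v) =
    overlapq H r + X1 + X2 - X3 - X4 - X5 + X6.
  rewrite /overlapq (@esum_contract _ _ _ _ uv Huv (rcard2 r)) //; last first.
  - by move=> i j; apply: rcard2_merge_old.
  - by move=> i j; rewrite rcard2C.
  - by move=> i j; rewrite rcard2C.
  rewrite -/p -/q mulrDr -!addrA; congr (_ + _).
  rewrite mulrA [1 / 2 * 2]mulrC divrr ?unitfE // mul1r.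
  under eq_bigr => k kP do rewrite rcard2_merge_new //.
  rewrite (sum_restrict uv); first last.
  - by rewrite pv qv; ring.
  - by rewrite pu qu; ring.
  rewrite /X1 /X2 /X3 /X4 /X5 /X6 -!sumrN -!big_split; apply: eq_bigr => k _ /=.
  ring.
have -> : tsum G (fun i j _ => rcard2 r i j) =
    tsum H (fun i j _ => rcard2 r i j) + 2 * (rcard2 r u v * d + X3).
  rewrite (tsum_extension ext); congr (_ + _).
  rewrite /d /X3 mulr_sumr -big_split mulr_sumr; apply: eq_bigr => k _ /=.
  by rewrite (rcard2C r v u) (rcard2C r k u) (rcard2C r k v) -/p -/q; ring.
have -> : tsum G (rcard3 r) = tsum H (rcard3 r) + 6 * X6.
  rewrite (tsum_extension ext); congr (_ + _).
  rewrite /X6 mulr_sumr; apply: eq_bigr => k _ /=.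
  have -> : rcard3 r v k u = rcard3 r u v k by rewrite rcard3CA rcard3C.
  have -> : rcard3 r k u v = rcard3 r u v k by rewrite rcard3C rcard3CA.
  have -> : rcard3 r k v u = rcard3 r u v k by rewrite rcard3C rcard3CA rcard3C.
  by rewrite (rcard3C r v u) (rcard3CA r u k) -/p -/q; ring.
(* The guard that excludes degenerate paths is automatic on new ones, since [u] and [v] are not
   adjacent in [H]. *)
have pk k : p k * (v != k)%:R = p k.
  by case: (eqVneq v k) => [<-|_]; rewrite ?pv ?mul0r ?mulr1.
have qk k : q k * (u != k)%:R = q k.
  by case: (eqVneq u k) => [<-|_]; rewrite ?qu ?mul0r ?mulr1.
have -> : psum G (fun i j k => (j != k)%:R * rcard2 r j k) =
    psum H (fun i j k => (j != k)%:R * rcard2 r j k) + 2 * (X1 + X2).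
  rewrite (psum_extension ext); last by move=> i j; rewrite eqxx mul0r.
  rewrite -addrA; congr (_ + _); rewrite mulrDr /X1 /X2 !mulr_sumr.
  congr (_ + _); apply: eq_bigr => k _.
    by rewrite (eq_sym k v) (rcard2C r k v) -[in RHS]pk -/p; ring.
  by rewrite (eq_sym k u) (rcard2C r k u) -[in RHS]qk -/q; ring.
have -> : psum G (fun i j k => (j != k)%:R * rcard3 r i j k) =
    psum H (fun i j k => (j != k)%:R * rcard3 r i j k) + 2 * (X4 + X5).
  rewrite (psum_extension ext); last by move=> i j; rewrite eqxx mul0r.
  rewrite -addrA; congr (_ + _); rewrite mulrDr /X4 /X5 !mulr_sumr.
  congr (_ + _); apply: eq_bigr => k _.
    by rewrite (eq_sym k v) (rcard3CA r u k) -[in RHS]pk -/p; ring.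
  rewrite (eq_sym k u) (rcard3CA r v k) (rcard3C r v u) -[in RHS]qk -/q; ring.
have -> : triangleq G = triangleq H + d.
  by rewrite /triangleq (tsum_extension ext) -mulr_suml -/p -/q -/d; field.
have -> : edgeq G = edgeq H + 1 by rewrite /edgeq (esum_extension ext); field.
have -> : overlapq G r = overlapq H r + rcard2 r u v.
  by rewrite /overlapq (esum_extension ext) (rcard2C r v u); field.
rewrite !(esum_extension ext) (rcard2C r v u).
by field.
Qed.

End RestraintCards.

(** * The sums of the statement *)

(** Newton's identity again, for index-ordered sums. The weights live on [nat] so that they survive
    the change of index type in the induction on [n]. *)
Lemma sum_increasing_triples (n : nat) (c : nat -> rat) :
  \sum_(i < n) \sum_(j < n | (i < j)%N) \sum_(k < n | (j < k)%N) c i * c j * c k =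
  ((\sum_(i < n) c i) ^+ 3 - 3 * (\sum_(i < n) c i) * (\sum_(i < n) c i ^+ 2)
   + 2 * (\sum_(i < n) c i ^+ 3)) / 6.
Proof.
have rec n' (F : nat -> nat -> rat) : \sum_(i < n'.+1) \sum_(j < n'.+1 | (i < j)%N) F i j =
    \sum_(i < n') (\sum_(j < n' | (i < j)%N) F i j + F i n').
  rewrite big_ord_recr /= [X in _ + X]big1 ?addr0; last first.
    by move=> j; rewrite ltnNge -ltnS ltn_ord.
  apply: eq_bigr => i _; rewrite big_mkcond big_ord_recr /= ltn_ord -big_mkcond.
  by [].
have pairs m : \sum_(i < m) \sum_(j < m | (i < j)%N) c i * c j =
    ((\sum_(i < m) c i) ^+ 2 - \sum_(i < m) c i ^+ 2) / 2.
  elim: m => [|m IH]; first by rewrite !big_ord0; field.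
  rewrite (rec m (fun i j => c i * c j)) big_split /= IH -mulr_suml !big_ord_recr /=.
  by field.
elim: n => [|n IH]; first by rewrite !big_ord0; field.
rewrite (rec n (fun i j => \sum_(k < n.+1 | (j < k)%N) c i * c j * c k)).
(* The middle index cannot be the last one, as nothing lies above it. *)
have last0 i : \sum_(k < n.+1 | (n < k)%N) c i * c n * c k = 0.
  by rewrite big1 // => k; rewrite ltnNge -ltnS ltn_ord.
under eq_bigr => i _.
  rewrite last0 addr0.
  under eq_bigr => j _ do rewrite big_mkcond big_ord_recr /= ltn_ord -big_mkcond /=.
  rewrite big_split /=.
  over.
rewrite big_split /= IH.
under [X in _ + X]eq_bigr => i _ do rewrite -mulr_suml.
by rewrite -mulr_suml pairs !big_ord_recr /=; field.
Qed.

Section OrderedSums.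
Variables (n : nat) (G : sgraph 'I_n) (r : restraint 'I_n).

Lemma sum_increasing_pairs (F : 'I_n -> 'I_n -> rat) : (forall i j, F i j = F j i) ->
  \sum_(i < n) \sum_(j < n | (i < j)%N) F i j =
  1 / 2 * (\sum_i \sum_j F i j - \sum_i F i i).
Proof.
move=> Fs; set S := LHS.
have S2 : S = \sum_(i < n) \sum_(j < n | (j < i)%N) F i j.
  rewrite /S (exchange_big_dep predT) //=; apply: eq_bigr => i _.
  by apply: eq_bigr => j _.
suff -> : \sum_i \sum_j F i j = S + S + \sum_i F i i by field.
rewrite [X in _ = _ + X + _]S2 /S -!big_split; apply: eq_bigr => i _ /=.
rewrite (bigD1 i) //= addrC; congr (_ + _).
rewrite (bigID (fun j : 'I_n => (i < j)%N)) /=; congr (_ + _); apply: eq_bigl => j;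
  rewrite -(inj_eq val_inj) /=; lia.
Qed.

Lemma sum_edges (F : 'I_n -> 'I_n -> rat) : (forall i j, F i j = F j i) ->
  \sum_(i < n) \sum_(j < n | (i < j)%N && G i j) F i j = 1 / 2 * esum G F.
Proof.
move=> Fs; under eq_bigr => i _ do rewrite big_mkcondr /=.
rewrite (sum_increasing_pairs (F := fun i j => if G i j then F i j else 0)); last first.
  by move=> i j; rewrite adj_sym Fs.
rewrite [X in _ - X]big1 ?subr0; last by move=> i _; rewrite adj_irr.
congr (_ * _); apply: eq_bigr => i _; apply: eq_bigr => j _; rewrite /adjq.
by case: (G i j); rewrite ?mul1r ?mul0r.
Qed.

Lemma sum_nbr (F : 'I_n -> rat) i :
  \sum_(j in nbr G i) F j = \sum_j adjq G i j * F j.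
Proof.
rewrite big_mkcond; apply: eq_bigr => j _; rewrite inE /adjq.
by case: (G i j); rewrite ?mul1r ?mul0r.
Qed.

Lemma sum_nbr_cond (P : pred 'I_n) (F : 'I_n -> rat) i :
  \sum_(j in nbr G i | P j) F j = \sum_(j | P j) adjq G i j * F j.
Proof.
rewrite big_mkcondl; apply: eq_bigr => j _; rewrite inE /adjq.
by case: (G i j); rewrite ?mul1r ?mul0r.
Qed.

Lemma natr_bin2 m : 'C(m, 2)%:R = m%:R * (m%:R - 1) / 2 :> rat.
Proof.
elim: m => [|m IH]; first by rewrite bin0n /=; field.
by rewrite binS bin1 natrD IH -addn1 natrD; field.
Qed.

Lemma natr_bin3 m : 'C(m, 3)%:R = m%:R * (m%:R - 1) * (m%:R - 2) / 6 :> rat.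
Proof.
elim: m => [|m IH]; first by rewrite bin0n /=; field.
by rewrite binS natrD IH natr_bin2 -addn1 natrD; field.
Qed.

Lemma nedgesE : (nedges G)%:R = edgeq G. Proof. exact: nedges_esum. Qed.

Lemma trianglesE : (n_subgraphs G (cycle_graph 3))%:R = triangleq G.
Proof. by rewrite n_subgraphs_triangle n_cliques3. Qed.

Lemma A0E : A0 G = edgeq G * (edgeq G - 1) * (edgeq G - 2) / 6
  - (edgeq G - 2) * triangleq G
  - (n_induced G (cycle_graph 4))%:R + 2 * (n_cliques G 4)%:R.
Proof.
by rewrite /A0 /= natr_bin3 trianglesE nedgesE n_subgraphs_complete.
Qed.

Lemma A1E : A1 r = (rsum1 r ^+ 3 - 3 * rsum1 r * rsum2 r + 2 * rsum3 r) / 6.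
Proof.
(* Extension to [nat] with default 0, only ever evaluated at indices below [n]. *)
pose c i : rat := if insub i is Some i' then rcard1 r i' else 0.
have cE (i : 'I_n) : c i = rcard1 r i by rewrite /c valK.
have -> : rsum1 r = \sum_(i < n) c i by apply: eq_bigr => i _; rewrite cE.
have -> : rsum2 r = \sum_(i < n) c i ^+ 2 by apply: eq_bigr => i _; rewrite cE.
have -> : rsum3 r = \sum_(i < n) c i ^+ 3 by apply: eq_bigr => i _; rewrite cE.
rewrite -(sum_increasing_triples n c) /A1.
by apply: eq_bigr => i _; apply: eq_bigr => j _; apply: eq_bigr => k _; rewrite !cE.
Qed.

Lemma sum_rcard1_pairs :
  \sum_(i < n) \sum_(j < n | (i < j)%N) rcard1 r i * rcard1 r j =
  (rsum1 r ^+ 2 - rsum2 r) / 2.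
Proof.
rewrite (sum_increasing_pairs (F := fun i j => rcard1 r i * rcard1 r j)); last first.
  by move=> i j; rewrite mulrC.
have -> : \sum_i \sum_j rcard1 r i * rcard1 r j = rsum1 r ^+ 2.
  by rewrite expr2 /rsum1 mulr_suml; apply: eq_bigr => i _; rewrite mulr_sumr.
by rewrite /rsum2; field.
Qed.

Lemma A2E : A2 G r = (edgeq G - 1) * ((rsum1 r ^+ 2 - rsum2 r) / 2).
Proof. by rewrite -sum_rcard1_pairs /A2 /= nedgesE. Qed.

(** Non-adjacent pairs are all pairs minus the edges; the full pair sum raises the factor
    [edgeq G - 1] of [A2] to the [edgeq G] of [acoef3]. *)
Lemma A3E : A3 G r = (rsum1 r ^+ 2 - rsum2 r) / 2
  - 1 / 2 * esum G (fun i j => rcard1 r i * rcard1 r j).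
Proof.
rewrite -sum_rcard1_pairs -sum_edges; last by move=> i j; rewrite mulrC.
rewrite -sumrB /A3 /=; apply: eq_bigr => i _.
by rewrite [X in X - _](bigID (fun j => G i j)) /= addrC addrK.
Qed.

Lemma A4E : A4 G r =
  - (1 / 2 * esum G (fun i j => rcard2 r i j * (rsum1 r - rcard1 r i - rcard1 r j))).
Proof.
rewrite -sum_edges; last by move=> i j; rewrite rcard2C; ring.
rewrite /A4 /=; congr (- _); apply: eq_bigr => i _; apply: eq_bigr => j /andP[ij _].
congr (_ * _); have ij' : i != j by rewrite neq_ltn ij.
rewrite /rsum1 (sum_split1 ij') -!/(rcard1 _ _).
rewrite (eq_bigl (fun k => (k != i) && (k != j))); first by ring.
by move=> k; rewrite !inE negb_or.
Qed.

Lemma A5E : A5 G r = (edgeq G * (edgeq G - 1) / 2 - triangleq G) * rsum1 r.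
Proof. by rewrite /A5 /= natr_bin2 trianglesE nedgesE. Qed.

Lemma A6E : A6 G r = - ((edgeq G - 1) * overlapq G r).
Proof.
rewrite /overlapq -sum_edges; last exact: rcard2C.
by rewrite /A6 /= nedgesE mulNr.
Qed.

Lemma card_common_nbr i j : #|nbr G i :&: nbr G j|%:R = \sum_k adjq G i k * adjq G j k :> rat.
Proof.
rewrite -sum1_card natr_sum big_mkcond; apply: eq_bigr => k _.
by rewrite !inE /adjq; case: (G i k); case: (G j k).
Qed.

Lemma A7E : A7 G r = 1 / 2 * tsum G (fun i j k => rcard2 r i j)
  - 1 / 2 * psum G (fun i j k => (j != k)%:R * rcard2 r j k).
Proof.
rewrite /A7 /=; congr (_ - _).
  rewrite (sum_edges (F := fun i j => #|nbr G i :&: nbr G j|%:R * rcard2 r i j)).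
    congr (_ * _); apply: eq_bigr => i _; apply: eq_bigr => j _.
    by rewrite card_common_nbr mulr_suml mulr_sumr; apply: eq_bigr => k _; ring.
  by move=> i j; rewrite setIC rcard2C.
rewrite mulr_sumr; apply: eq_bigr => i _.
under eq_bigr => j _ do rewrite sum_nbr_cond.
rewrite (sum_nbr _ i) /=; under eq_bigr => j _ do rewrite mulr_sumr.
rewrite (sum_increasing_pairs (F := fun j k => adjq G i j * (adjq G i k * rcard2 r j k))).
  congr (_ * _); rewrite -sumrB; apply: eq_bigr => j _.
  rewrite (bigD1 j) //= [RHS](bigD1 j) //= eqxx mul0r mulr0 add0r addrC addrK.
  by apply: eq_bigr => k kj; rewrite eq_sym kj /=; ring.
by move=> j k; rewrite rcard2C; ring.
Qed.

(** For an ordered edge, the union of neighbourhoods gives the paths centred at either end minus the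
    triangles counted twice. With P the path sum and T the triangle sum, the total is (2P - T)/4 +
    T/12 = P/2 - T/6. *)
Lemma A8E : A8 G r = 1 / 2 * psum G (fun i j k => (j != k)%:R * rcard3 r i j k)
  - 1 / 6 * tsum G (rcard3 r).
Proof.
pose P := psum G (fun i j k => (j != k)%:R * rcard3 r i j k).
have -> : A8 G r = 1 / 2 * (1 / 2 * (P + P - tsum G (rcard3 r)))
    + 1 / 6 * (1 / 2 * tsum G (rcard3 r)).
  rewrite /A8 /=; congr (_ * _ + _ * _).
    rewrite (sum_edges (F := fun i j =>
      \sum_(k < n | (k \notin [set i; j]) && (k \in nbr G i :|: nbr G j)) rcard3 r i j k)).
      congr (_ * _).
      (* The same path sum with the centre in second position. *)
      have P2 : P = \sum_i \sum_j \sum_k adjq G i j * adjq G j k * ((i != k)%:R * rcard3 r i j k).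
        rewrite /P /psum exchange_big; apply: eq_bigr => i _; apply: eq_bigr => j _.
        by apply: eq_bigr => k _; rewrite (adjq_sym G j i) (rcard3C r j i).
      rewrite [X in _ = _ + X - _]P2 /P /psum /tsum -sumrN -!big_split.
      apply: eq_bigr => i _ /=; rewrite -sumrN -!big_split; apply: eq_bigr => j _ /=.
      rewrite -sumrN -!big_split mulr_sumr big_mkcond; apply: eq_bigr => k _ /=.
      rewrite !inE negb_or !(eq_sym k) /adjq.
      case: (eqVneq i k) => [<-|_]; case: (eqVneq j _) => [<-|_];
        rewrite ?adj_irr ?(adj_sym G j i); case: (G i _); case: (G _ _) => //=; ring.
    move=> i j; apply: eq_big => [k|k _]; last by rewrite rcard3C.
    by rewrite !inE; rewrite orbC (orbC (G i k)).
  rewrite (sum_edges (F := fun i j => \sum_(k in nbr G i :&: nbr G j) rcard3 r i j k)).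
    congr (_ * _); apply: eq_bigr => i _; apply: eq_bigr => j _.
    rewrite mulr_sumr big_mkcond; apply: eq_bigr => k _; rewrite !inE /adjq.
    by case: (G i k); case: (G j k); rewrite /= ?mulr0 ?mulr1 ?mul0r.
  move=> i j; apply: eq_big => [k|k _]; last by rewrite rcard3C.
  by rewrite setIC.
by rewrite -/P; field.
Qed.

End OrderedSums.

(** Agreement at all large integers determines the polynomial, so any admissible [a] has the
    coefficients of [restrained_poly]. *)
Lemma restrained_coeffs_unique (n : nat) (G : sgraph 'I_n) (r : restraint 'I_n)
    (a : nat -> int) (k : nat) :
  restrained_coeffs G r a -> (k <= n)%N -> a (n - k)%N = acoef G r k.
Proof.
move=> ha kn.
have E : restrained_poly G r = \poly_(i < n.+1) ((-1) ^+ (n - i) * a i).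
  apply: (@poly_eq_large _ _ (max_forbidden r)) => x Mx.
  by rewrite -restrained_polyE // ha // horner_poly.
rewrite /acoef E card_ord coef_poly ltnS leq_subr subKn // mulrA -exprMn.
by rewrite mulrNN mulr1 expr1n mul1r.
Qed.

Theorem theorem4p4 (n : nat) (G : sgraph 'I_n) (r : restraint 'I_n)
    (a : nat -> int)
    (hn : (3 <= n)%N)
    (ha : restrained_coeffs G r a) :
  (a (n - 3)%N)%:~R
    = A0 G + (A1 r + A2 G r + A3 G r + A4 G r + A5 G r + A6 G r + A7 G r
              + A8 G r) :> rat.
Proof.
rewrite (restrained_coeffs_unique ha hn) acoef3 ?card_ord //.
rewrite A0E A1E A2E A3E A4E A5E A6E A7E A8E; ring.
Qed.
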